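(* Assume that the drift condition, the long-time contractivity condition, the minorization condition and the smallness condition (all stated in the context) hold. Let $\mu_*$ be the probability measure on $(\mathcal X,\mathcal B)$ to which $\mathrm{Law}(X_N)$ converges in total variation as $N\to\infty$ (this limit exists under these conditions and does not depend on $x_0$). If $Y$ is ergodic, then for every bounded measurable $\Phi:\mathcal X\to\mathbb R$, $$\frac{\Phi(X_1)+\ldots+\Phi(X_N)}{N}\to\int_{\mathcal X}\Phi(z)\,\mu_*(dz),\qquad N\to\infty,$$ in $L^p$ for all $1\le p<\infty$.
   Context: Let $(\Omega,\mathcal F,\mathbb P)$ be a probability space, $(\mathcal X,\mathcal B)$ a standard Borel space, $(\mathcal Y,\mathcal A)$ a measurable space, and $Y=(Y_t)_{t\in\mathbb Z}$ a strictly stationary $\mathcal Y$-valued process on $\Omega$ (the environment). Let $Q:\mathcal Y\times\mathcal X\times\mathcal B\to[0,1]$ be such that $(y,x)\mapsto Q(y,x,B)$ is $\mathcal A\otimes\mathcal B$-measurable for each $B\in\mathcal B$ and $Q(y,x,\cdot)$ is a probability measure for each $(y,x)$. For nonnegative measurable $\phi$ put $[Q(y)\phi](x)=\int_{\mathcal X}\phi(z)\,Q(y,x,dz)$. The process $X=(X_t)_{t\in\mathbb N}$ is $\mathcal X$-valued, $X_0=x_0\in\mathcal X$ is deterministic, and $\mathbb P(X_{t+1}\in B\mid\mathcal F_t)=Q(Y_t,X_t,B)$ a.s. for all $t\in\mathbb N$, $B\in\mathcal B$, where $\mathcal F_t=\sigma(X_s,0\le s\le t;\ Y_s,s\in\mathbb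 Z)$. Total variation distance: $d_{TV}(\mu_1,\mu_2)=|\mu_1-\mu_2|(\mathcal X)$. Ergodicity of $Y$: with $S:\mathcal Y^{\mathbb Z}\to\mathcal Y^{\mathbb Z}$, $(S\mathbf y)_j=\mathbf y_{j+1}$, every $A\in\mathcal A^{\otimes\mathbb Z}$ with $S^{-1}(A)=A$ satisfies $\mathbb P(Y\in A)\in\{0,1\}$. Drift condition: there are a measurable $V:\mathcal X\to[0,\infty)$ and measurable $\gamma:\mathcal Y\to(0,\infty)$, $K:\mathcal Y\to[1,\infty)$ with $[Q(y)V](x)\le\gamma(y)V(x)+K(y)$ for all $x\in\mathcal X,y\in\mathcal Y$. Long-time contractivity condition: $\bar\gamma:=\limsup_{n\to\infty}\left(\mathbb E\left[K(Y_0)\prod_{k=1}^n\gamma(Y_k)\right]\right)^{1/n}<1$. Minorization condition: for some $0<\epsilon<1/\bar\gamma^{1/2}-1$ (so implicitly $\bar\gamma>0$) there are a measurable $\alpha:\mathcal Y\to[0,1)$ and a probability kernel $\kappa:\mathcal Y\times\mathcal B\to[0,1]$ such that for all $y\in\mathcal Y$, $A\in\mathcal B$: $\inf_{x\in V^{-1}([0,R(y)])}Q(y,x,A)\ge(1-\alpha(y))\kappa(y,A)$, where $R(y)=\frac{2K(y)}{\epsilon\gamma(y)}$, and $V^{-1}([0,R(y)])\ne\emptyset$. Smallness condition: there is $0<\theta<1$ with $\lim_{n\to\infty}\left(\mathbb E[\alpha(Y_0)^n]\right)^{1/n^\theta}=0$. *)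

(* Defs.v *)
From HB Require Import structures.
From mathcomp Require Import all_boot all_order all_algebra.
From mathcomp Require Import all_classical all_reals all_analysis.
From mathcomp Require Import measurable_realfun.

Set Implicit Arguments.
Unset Strict Implicit.
Unset Printing Implicit Defensive.

Import Order.TTheory GRing.Theory Num.Theory.
Import numFieldNormedType.Exports.

Local Open Scope classical_set_scope.
Local Open Scope ring_scope.

(* The sigma-algebra of X is, up to a bijection f, the Borel sigma-algebra of a
   complete separable metric space. *)
Definition standard_borel (R : realType) (d : measure_display)
    (X : measurableType d) : Prop :=
  exists (M : metricType R) (f : X -> M),
    [/\ forall F : set_system M, ProperFilter F -> cauchy F -> exists l : M, F --> l,
        exists2 D : set M, countable D & dense D,
        bijective f &
        @measurable d X = preimage_set_system setT f <<s @open M >>].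

Section total_variation.
Context (R : realType) (d : measure_display) (T : measurableType d).

Definition charge_diff (m1 m2 : {finite_measure set T -> \bar R}) :
    {charge set T -> \bar R} :=
  cadd (charge_of_finite_measure m1) (copp (charge_of_finite_measure m2)).

(* |nu|(T); the Hahn decomposition is chosen, charge_variation does not depend
   on the choice. *)
Definition total_variation (nu : {charge set T -> \bar R}) : \bar R :=
  let: exist _ PN := cid (Hahn_decomposition nu) in
  let: exist _ nuPN := cid PN in
  charge_variation nuPN setT.

Definition dTV (m1 m2 : {finite_measure set T -> \bar R}) : \bar R :=
  total_variation (charge_diff m1 m2).

End total_variation.

Section environment.
Context (R : realType) (dO dY : measure_display).
Context (Omega : measurableType dO) (Ysp : measurableType dY).
Variable P : probability Omega R.

Definition path_measurable : set_system (int -> Ysp) :=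
  <<s \bigcup_(t in [set: int])
        preimage_set_system setT (fun y : int -> Ysp => y t) measurable >>.

Definition env_path (Y : int -> {RV P >-> Ysp}) (w : Omega) : int -> Ysp :=
  fun t => Y t w.

Definition shift_path (y : int -> Ysp) : int -> Ysp := fun j => y (j + 1).

Definition strictly_stationary (Y : int -> {RV P >-> Ysp}) : Prop :=
  forall (h : int) (A : set (int -> Ysp)), path_measurable A ->
    P (env_path (fun t => Y (t + h)) @^-1` A) = P (env_path Y @^-1` A).

Definition ergodic_process (Y : int -> {RV P >-> Ysp}) : Prop :=
  forall A : set (int -> Ysp), path_measurable A ->
    shift_path @^-1` A = A ->
    P (env_path Y @^-1` A) = 0%E \/ P (env_path Y @^-1` A) = 1%E.

(* f is a version of P(E | G), for a sub-sigma-algebra G *)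
Definition is_cond_prob (G : set_system Omega) (E : set Omega)
    (f : Omega -> \bar R) : Prop :=
  (forall B : set (\bar R), measurable B -> G (f @^-1` B)) /\
  (forall A : set Omega, G A -> (\int[P]_(w in A) f w)%E = P (E `&` A)).

End environment.

Section chain.
Context (R : realType) (dO dX dY : measure_display).
Context (Omega : measurableType dO) (Xsp : measurableType dX)
  (Ysp : measurableType dY).
Variable P : probability Omega R.
Variable Y : int -> {RV P >-> Ysp}.
Variable Q : R.-pker (Ysp * Xsp)%type ~> Xsp.

Definition chain_filtration (X : nat -> {RV P >-> Xsp}) (t : nat) :
    set_system Omega :=
  <<s (\bigcup_(s in [set s : nat | (s <= t)%N])
         preimage_set_system setT (X s) measurable)
      `|`
      (\bigcup_(s in [set: int]) preimage_set_system setT (Y s) measurable) >>.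

(* w |-> Q (Y t w, X t w) B is itself measurable with respect to
   chain_filtration X t, so P(X_(t+1) in B | F_t) = Q(Y_t, X_t, B) a.s. means
   that it is a version of this conditional probability. *)
Definition chain_in_environment (x0 : Xsp) (X : nat -> {RV P >-> Xsp}) : Prop :=
  (forall w, X 0%N w = x0) /\
  (forall (t : nat) (B : set Xsp), measurable B ->
     is_cond_prob P (chain_filtration X t) (X t.+1 @^-1` B)
       (fun w => Q (Y t%:Z w, X t w) B)).

Definition drift_condition (V : Xsp -> R) (gamma K : Ysp -> R) : Prop :=
  [/\ measurable_fun setT V /\ (forall x, 0 <= V x),
      measurable_fun setT gamma /\ (forall y, 0 < gamma y),
      measurable_fun setT K /\ (forall y, 1 <= K y) &
      forall x y,
        (\int[Q (y, x)]_z (V z)%:E <= (gamma y * V x + K y)%:E)%E].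

Definition gamma_bar (gamma K : Ysp -> R) : \bar R :=
  limn_esup (fun n : nat =>
    ('E_P[(fun w => (K (Y 0 w) *
             \prod_(1 <= k < n.+1) gamma (Y k%:Z w))%R)] `^ (n%:R^-1)%R)%E).

Definition contractivity_condition (gamma K : Ysp -> R) : Prop :=
  (gamma_bar gamma K < 1)%E.

Definition small_set (V : Xsp -> R) (gamma K : Ysp -> R) (eps : R) (y : Ysp) :
    set Xsp :=
  V @^-1` `[0, 2 * K y / (eps * gamma y)].

(* Under the contractivity condition gamma_bar is finite, so that fine
   is harmless. *)
Definition minorization_condition (V : Xsp -> R) (gamma K : Ysp -> R) (eps : R)
    (alpha : Ysp -> R) (kappa : R.-pker Ysp ~> Xsp) : Prop :=
  [/\ (0 < gamma_bar gamma K)%E,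
      0 < eps < (Num.sqrt (fine (gamma_bar gamma K)))^-1 - 1,
      measurable_fun setT alpha /\ (forall y, 0 <= alpha y < 1) &
      forall y, small_set V gamma K eps y !=set0 /\
        forall A : set Xsp, measurable A ->
          ((1 - alpha y)%:E * kappa y A <=
           ereal_inf [set Q (y, x) A | x in small_set V gamma K eps y])%E].

Definition smallness_condition (alpha : Ysp -> R) (theta : R) : Prop :=
  0 < theta < 1 /\
  ('E_P[(fun w => (alpha (Y 0 w) ^+ n)%R)] `^ ((n%:R `^ theta)^-1)%R)%E
    @[n --> \oo] --> 0%E.

End chain.

(* Main.v *)
Require Import Defs.
From HB Require Import structures.
From mathcomp Require Import all_boot all_order all_algebra.
From mathcomp Require Import all_classical all_reals all_analysis.
From mathcomp Require Import measurable_realfun ring lra.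
Import Order.TTheory GRing.Theory Num.Theory.
Import numFieldNormedType.Exports.

Set Implicit Arguments.
Unset Strict Implicit.
Unset Printing Implicit Defensive.

Local Open Scope classical_set_scope.
Local Open Scope ring_scope.

(* The chain is compared with itself through weighted distances
   1 + c(y) (V x + V x') whose weight c depends on the past of the environment y.
   With T the shift of environments, c is the largest function such that
   c(T y) gamma(y_0) <= sigma c(y) and c(T y) <= (1 - alpha(y_0)) / (4 K(y_0)),
   where gamma_bar < sigma < 1 / (1 + eps).  The drift condition controls pairs
   outside the small set and the minorization condition pairs inside it, so one
   step of the chain contracts this distance by a factor rho(y) <= 1, with
   rho(y) < 1 as soon as c(y) > 0.  By Borel-Cantelli, the contractivity and
   smallness conditions give c > 0 almost surely; by stationarity the product of
   rho along n steps then tends to 0 in mean.  Since c <= 1 and c V is bounded in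
   mean along the chain, conditionally on the environment, the law of X_n is Cauchy
   in total variation.

   For the law of large numbers, f(X_k) is replaced by its conditional mean given
   the environment for a chain restarted from x0 at time k - m.  The differences
   decorrelate at distance m, hence their averages are small in L2, and the
   conditional means form a function of T^(k-m) Y, to which the ergodic theorem
   applies. *)

(** * Bounded functions and minorized measures *)

(** The drift contracts V only on average: [gamma] may exceed 1 in some environments and [alpha] may
    come arbitrarily close to 1, so no fixed weighted distance contracts at every step. A weight
    that follows the environment repairs this, at the price that rho is below 1 without a uniform
    margin. No speed is therefore available: the errors are expressed through the single sequence
    [mean_rate], of which only the convergence to 0 is used.

    The room for sigma comes from eps < gamma_bar^(-1/2) - 1 together with gamma_bar < 1. The gap
    also has to hold a smaller number s', since Borel-Cantelli needs a geometric margin between the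
    two.

    The ergodic theorem cannot be applied to f(X_k) directly, because it is not a fixed function
    evaluated along a stationary orbit. Restarting from the constant x0 produces such a function,
    with a bias controlled by the mean rate at m; the lag m is fixed before the length of the
    average grows. Boundedness of f finally lifts convergence in L1 to every Lp. *)

Lemma lt_archi_bound (R : archiRealFieldType) (x : R) : x < (Num.bound `|x|)%:R.
Proof. by rewrite (le_lt_trans (ler_norm x))// archi_boundP. Qed.

Lemma nneseries_geometric_lty (R : realType) (u : nat -> \bar R) (C r : R) :
  0 <= C -> 0 <= r -> r < 1 -> (forall k, (0 <= u k)%E) ->
  (forall k, (u k <= (C * r ^+ k)%:E)%E) -> (\sum_(k <oo) u k < +oo)%E.
Proof.
move=> C0 r0 r1 u0 uC; apply: (@le_lt_trans _ _ (C / (1 - r))%:E); last exact: ltry.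
apply: lime_le; first exact: is_cvg_nneseries.
apply: nearW => n.
apply: (@le_trans _ _ (\sum_(0 <= k < n) (C * r ^+ k)%:E)%E); first exact: lee_sum.
rewrite sumEFin lee_fin -mulr_sumr ler_wpM2l// -[leRHS]mul1r ler_pdivlMr ?subr_gt0//.
suff -> : (\sum_(0 <= k < n) r ^+ k) * (1 - r) = 1 - r ^+ n.
  by rewrite gerBl exprn_ge0.
elim: n => [|n IH]; first by rewrite big_nil mul0r expr0 subrr.
by rewrite big_nat_recr//= mulrDl IH exprS; ring.
Qed.

Section bounded_functions.
Context d (T : measurableType d) (R : realType).
Implicit Types (m : {measure set T -> \bar R}) (f g : T -> R).

Lemma measurable_lt_set f g : measurable_fun setT f -> measurable_fun setT g ->
  measurable [set x | f x < g x].
Proof.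
move=> mf mg; rewrite (_ : [set _ | _] = ~` (setT `&` [set x | g x <= f x])).
  by apply: measurableC; exact: measurable_fun_le.
apply/seteqP; split => x /= h; first by case; rewrite leNgt h.
by rewrite ltNge; apply/negP => fg; exact: h.
Qed.

Lemma measurable_funV f : measurable_fun setT f -> (forall x, 0 <= f x) ->
  measurable_fun setT (fun x => (f x)^-1).
Proof.
move=> mf f0; rewrite (_ : (fun _ => _) = (@powR R ^~ (-1)) \o f).
  exact: (measurableT_comp (measurable_powR (-1))).
by apply/funext => x /=; rewrite powR_inv1.
Qed.

Lemma markov_set m f (c : R) : measurable_fun setT f -> (forall x, 0 <= f x) ->
  0 < c -> (c%:E * m [set x | (c <= f x)%R] <= \int[m]_x (f x)%:E)%E.
Proof.
move=> mf f0 c0; have mA : measurable [set x | c <= f x].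
  rewrite -[X in measurable X]setTI.
  by apply: (measurable_fun_le (f := cst c)).
have -> : (c%:E * m [set x | (c <= f x)%R] =
    \int[m]_x (c%:E * (\1_[set x | (c <= f x)%R] x)%:E))%E.
  rewrite ge0_integralZl//;
    first [by rewrite integral_indic// setIT
          |by apply/measurable_EFinP; exact: measurable_indic
          |by rewrite lee_fin ltW].
apply: ge0_le_integral => //;
  first [by move=> x _; rewrite -EFinM lee_fin mulr_ge0// ltW
        |by apply/measurable_EFinP; apply: measurable_funM => //; exact: measurable_indic
        |exact/measurable_EFinP
        |by move=> x _; rewrite lee_fin
        |idtac].
move=> x _; rewrite -EFinM lee_fin indicE.
by have [|] := boolP (x \in _); rewrite ?inE/= ?mulr1// mulr0.
Qed.

Lemma bounded_integrable m f (M : R) : m setT = 1%E ->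
  measurable_fun setT f -> (forall x, `|f x| <= M) ->
  m.-integrable setT (EFin \o f).
Proof.
move=> m1 mf fM; apply: measurable_bounded_integrable => //.
  by rewrite m1 ltry.
exists M; split; first exact: num_real.
by move=> N MN x _ /=; rewrite (le_trans (fM x))// ltW.
Qed.

Lemma bounded_fin_num_integral m f (M : R) : m setT = 1%E ->
  measurable_fun setT f -> (forall x, `|f x| <= M) ->
  (\int[m]_x (f x)%:E)%E = (\int[m]_x f x)%:E.
Proof.
move=> m1 mf fM; rewrite /Rintegral fineK//.
by apply: integrable_fin_num => //; exact: bounded_integrable m1 mf fM.
Qed.

Lemma Rintegral_cst1 m (r : R) : m setT = 1%E -> \int[m]_x r = r.
Proof. by move=> m1; rewrite Rintegral_cst// m1 mulr1. Qed.

Lemma Rintegral_bounded m f (M : R) : m setT = 1%E ->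
  measurable_fun setT f -> (forall x, `|f x| <= M) -> `|\int[m]_x f x| <= M.
Proof.
move=> m1 mf fM.
rewrite (le_trans (le_normr_Rintegral _ _))//.
  exact: bounded_integrable m1 mf fM.
rewrite -[leRHS](Rintegral_cst1 M m1); apply: le_Rintegral => //.
- apply: (bounded_integrable m1 (M := M)).
  + by apply: measurableT_comp.
  + by move=> x /=; rewrite normr_id.
- exact: (bounded_integrable m1 (M := `|M|)).
Qed.

Lemma Rintegral_indic m (A : set T) : measurable A ->
  \int[m]_x (\1_A x) = fine (m A).
Proof. by move=> mA; rewrite /Rintegral integral_indic// setIT. Qed.

Lemma bounded_cvg_Rintegral m (f_ : nat -> T -> R) f (M : R) : m setT = 1%E ->
  (forall n, measurable_fun setT (f_ n)) -> measurable_fun setT f ->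
  (forall n x, `|f_ n x| <= M) -> {ae m, forall x, f_ ^~ x @ \oo --> f x} ->
  \int[m]_x f_ n x @[n --> \oo] --> \int[m]_x f x.
Proof.
move=> m1 mf_ mf fM cf; rewrite /Rintegral; apply: fine_cvg.
have mE g : measurable_fun setT g -> measurable_fun setT (EFin \o g).
  by move=> mg; exact/measurable_EFinP.
have [| | | | |/integrable_fin_num fi _ c] := @dominated_convergence _ _ _ m setT
  measurableT (fun n => EFin \o f_ n) (EFin \o f) (cst M%:E).
- by move=> n; exact: mE.
- exact: mE.
- by apply: filterS cf => x h _; apply/fine_cvgP; split => //; exact: nearW.
- exact: (bounded_integrable m1 (M := `|M|)).
- by apply: aeW => x n _; rewrite /= lee_fin.
by rewrite fineK//; exact: fi.
Qed.

(* With B = {f >= 1/2}, f = (1_B + f1) / 2 where f1 = 2 f - 1_B is again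
   [0, 1]-valued: iterating halves the error at each step. *)
Lemma le_Rintegral_measure m1 m2 (s del : R) f : m1 setT = 1%E -> m2 setT = 1%E ->
  0 <= s <= 1 ->
  (forall B, measurable B -> s * fine (m1 B) - fine (m2 B) <= del) ->
  measurable_fun setT f -> (forall x, 0 <= f x <= 1) ->
  s * \int[m1]_x f x - \int[m2]_x f x <= del.
Proof.
move=> h1 h2 /andP[s0 s1] sB.
have d0 : 0 <= del by have := sB set0 measurable0; rewrite !measure0 /= mulr0 subrr.
have bint m (h : m setT = 1%E) g : measurable_fun setT g -> (forall x, 0 <= g x <= 1) ->
    m.-integrable setT (EFin \o g).
  move=> mg g01; apply: (bounded_integrable h mg (M := 1)) => x.
  by have /andP[? ?] := g01 x; rewrite ger0_norm.
have step k : forall f, measurable_fun setT f -> (forall x, 0 <= f x <= 1) ->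
    s * \int[m1]_x f x - \int[m2]_x f x <= del + (2^-1) ^+ k.
  elim: k => [|k IH] g mg g01.
    rewrite expr0.
    have i2 : 0 <= \int[m2]_x g x.
      by apply: Rintegral_ge0 => x _; have /andP[] := g01 x.
    have : `|\int[m1]_x g x| <= 1.
      apply: Rintegral_bounded => // x.
      by have /andP[? ?] := g01 x; rewrite ger0_norm.
    rewrite ler_norml => /andP[_ i1].
    have : s * \int[m1]_x g x <= 1.
      rewrite (le_trans (ler_wpM2l s0 i1))// mulr1//.
    lra.
  pose B := [set x | 2^-1 <= g x].
  have mB : measurable B.
    by rewrite -[B]setTI; exact: measurable_fun_le.
  pose g1 x := 2 * g x - \1_B x.
  have mI : measurable_fun setT (\1_B : T -> R) by exact: measurable_indic.
  have mg1 : measurable_fun setT g1.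
    by apply: measurable_funB => //; exact: measurable_funM.
  have g101 x : 0 <= g1 x <= 1.
    rewrite /g1 indicE; have := g01 x.
    have [|] := boolP (x \in B); rewrite ?inE ?notin_setE /B/= => h /=.
      by move=> ?; lra.
    by move/negP : h; rewrite -ltNge => h ?; lra.
  have eg m (h : m setT = 1%E) :
      \int[m]_x g x = 2^-1 * (fine (m B) + \int[m]_x g1 x).
    rewrite -Rintegral_indic// -RintegralD//; last 2 first.
    - by apply: bint => // x; rewrite indicE; case: (_ \in _); rewrite /= lexx ler01.
    - exact: bint.
    rewrite -RintegralZl//.
      by apply: eq_Rintegral => x _; rewrite /g1; lra.
    apply: (bounded_integrable h (M := 2)).
      by apply: measurable_funD => //; exact: measurable_funD.
    move=> x; rewrite indicE; have := g101 x.
    by case: (_ \in _) => /= /andP[? ?]; rewrite ger0_norm; lra.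
  rewrite (eg m1)// (eg m2)//.
  have := IH _ mg1 g101; have := sB _ mB; rewrite exprS.
  set e := 2^-1 ^+ k; lra.
move=> mf f01; apply/ler_addgt0Pr => e e0.
have /cvgrPdist_lt /(_ e e0) [N _ /(_ N (leqnn N))] :
    (2^-1 : R) ^+ n @[n --> \oo] --> (0 : R).
  by apply: cvg_expr; rewrite ger0_norm; lra.
rewrite sub0r normrN ger0_norm; last by apply: exprn_ge0; lra.
move=> /= hN; apply: (le_trans (step N _ mf f01)); lra.
Qed.

(** The rescaling (f + M) / (2 M) is [0, 1]-valued, so the one-sided bound with s = 1 applies to it
    in both directions; scaling back gives the factor 2 M. The case M = 0 is separate because of the
    division. *)
Lemma Rintegral_close m1 m2 (del M : R) f : m1 setT = 1%E -> m2 setT = 1%E ->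
  (forall B, measurable B -> `|fine (m1 B) - fine (m2 B)| <= del) ->
  measurable_fun setT f -> (forall x, `|f x| <= M) ->
  `|\int[m1]_x f x - \int[m2]_x f x| <= 2 * M * del.
Proof.
move=> h1 h2 hB mf fM.
have M0 : 0 <= M by rewrite (le_trans _ (fM point)).
move: M0; rewrite le_eqVlt => /predU1P[M0|M0].
  have i m (h : m setT = 1%E) : \int[m]_x f x = 0.
    by apply/eqP; rewrite -normr_le0 [leRHS]M0 (Rintegral_bounded h).
  by rewrite !i// subrr normr0 -M0 mulr0 mul0r.
pose g x := (f x + M) / (2 * M).
have mg : measurable_fun setT g.
  by apply: measurable_funM => //; exact: measurable_funD.
have g01 x : 0 <= g x <= 1.
  have := fM x; rewrite ler_norml => /andP[? ?].
  rewrite /g divr_ge0 /=; [|lra|lra].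
  by rewrite ler_pdivrMr; lra.
have gE x : f x = 2 * M * g x - M.
  by rewrite /g mulrCA divff ?mulr1 ?addrK// mulf_neq0// gt_eqF.
have gi m (h : m setT = 1%E) : m.-integrable setT (EFin \o g).
  apply: (bounded_integrable h mg (M := 1)) => x.
  by have /andP[? ?] := g01 x; rewrite ger0_norm.
have i m (h : m setT = 1%E) : \int[m]_x f x = 2 * M * \int[m]_x g x - M.
  rewrite -RintegralZl//; last exact: gi.
  rewrite -[X in _ = _ - X](Rintegral_cst1 M h) -RintegralB//; last 2 first.
  - apply: (bounded_integrable h (M := 2 * M)); first exact: measurable_funM.
    move=> x; have /andP[? ?] := g01 x.
    have M2 : 0 <= 2 * M by lra.
    have : 0 <= 2 * M * g x by exact: mulr_ge0.
    move=> gM0; rewrite /= (ger0_norm gM0); nra.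
  - exact: (bounded_integrable h (M := `|M|)).
  by apply: eq_Rintegral => x _; exact: gE.
have a01 : 0 <= (1 : R) <= 1 by rewrite ler01 lexx.
have := @le_Rintegral_measure m1 m2 1 del g h1 h2 a01.
have := @le_Rintegral_measure m2 m1 1 del g h2 h1 a01.
rewrite !mul1r => k2 k1.
rewrite (i m1)// (i m2)//.
rewrite (_ : _ - _ = 2 * M * (\int[m1]_x g x - \int[m2]_x g x)); last by ring.
rewrite normrM ger0_norm; last lra.
rewrite ler_wpM2l//; first lra.
rewrite ler_norml lerNl opprB k2 ?k1//.
- by move=> B mB; have := hB _ mB; rewrite ler_norml mul1r => /andP[].
- by move=> B mB; have := hB _ mB; rewrite ler_norml mul1r => /andP[]; lra.
Qed.

(* A one-step coupling estimate without coupling: for w := sup (f - b V),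
   h1 := w + b V - f and h2 := f - w + A + b V are nonnegative with
   h1 + h2 >= A, so the common part of m1 and m2 contributes (1 - a) A. *)
Lemma minorized_contraction (m1 m2 k : {measure set T -> \bar R})
    (V f : T -> R) (A b a M : R) :
  m1 setT = 1%E -> m2 setT = 1%E -> k setT = 1%E -> 0 <= a <= 1 ->
  0 <= A -> 0 <= b ->
  (forall B, measurable B -> (1 - a) * fine (k B) <= fine (m1 B)) ->
  (forall B, measurable B -> (1 - a) * fine (k B) <= fine (m2 B)) ->
  (forall x, 0 <= V x) -> m1.-integrable setT (EFin \o V) ->
  m2.-integrable setT (EFin \o V) ->
  measurable_fun setT f -> (forall x, `|f x| <= M) ->
  (forall x y, `|f x - f y| <= A + b * (V x + V y)) ->
  \int[m1]_x f x - \int[m2]_x f x <=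
    A * a + b * (\int[m1]_x V x + \int[m2]_x V x).
Proof.
move=> h1 h2 hk /andP[a0 a1] A0 b0 km1 km2 V0 iV1 iV2 mf fM fV.
have mV : measurable_fun setT V by apply/measurable_EFinP; case/integrableP : iV1.
pose S := range (fun x => f x - b * V x).
have bV0 x : 0 <= b * V x by rewrite mulr_ge0.
have hS : has_sup S.
  split; first by exists (f point - b * V point); exists point.
  exists M => _ [x _ <-]; have := fM x; rewrite ler_norml => /andP[_ ?].
  by have := bV0 x; lra.
pose w := sup S.
have w1 x : f x - b * V x <= w by apply: sup_ubound; [case: hS|exists x].
have w2 y : w <= f y + A + b * V y.
  apply: ge_sup; first by case: hS.
  move=> _ [x _ <-]; have := fV x y; rewrite ler_norml => /andP[_].
  by rewrite mulrDr; lra.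
pose h1f x := w + b * V x - f x.
pose h2f x := f x - w + A + b * V x.
have mbV : measurable_fun setT (fun x => b * V x) by exact: measurable_funM.
have mh1 : measurable_fun setT h1f.
  by apply: measurable_funB => //; apply: measurable_funD.
have mh2 : measurable_fun setT h2f.
  by do 2 apply: measurable_funD => //; apply: measurable_funB.
have h10 x : 0 <= h1f x by have := w1 x; rewrite /h1f; lra.
have h20 x : 0 <= h2f x by have := w2 x; rewrite /h2f; lra.
have h12 x : A <= h1f x + h2f x by have := bV0 x; rewrite /h1f/h2f; lra.
have ic m (h : m setT = 1%E) r : m.-integrable setT (EFin \o cst r).
  exact: (bounded_integrable h (M := `|r|)).
have if_ m (h : m setT = 1%E) : m.-integrable setT (EFin \o f).
  exact: bounded_integrable h mf fM.
have ibV m (iV : m.-integrable setT (EFin \o V)) :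
    m.-integrable setT (EFin \o (fun x => b * V x)).
  by rewrite [X in _.-integrable _ X](_ : _ = fun x => (b%:E * (EFin \o V) x)%E)//;
    exact: integrableZl.
have iwV m (h : m setT = 1%E) (iV : m.-integrable setT (EFin \o V)) :
    m.-integrable setT (EFin \o (fun x => w + b * V x)).
  exact: (integrableD measurableT (ic _ h w) (ibV _ iV)).
have ifw m (h : m setT = 1%E) : m.-integrable setT (EFin \o (fun x => f x - w)).
  exact: (integrableB measurableT (if_ _ h) (ic _ h w)).
have ifwA m (h : m setT = 1%E) : m.-integrable setT (EFin \o (fun x => f x - w + A)).
  exact: (integrableD measurableT (ifw _ h) (ic _ h A)).
have ih1 : m1.-integrable setT (EFin \o h1f).
  exact: (integrableB measurableT (iwV _ h1 iV1) (if_ _ h1)).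
have ih2 : m2.-integrable setT (EFin \o h2f).
  exact: (integrableD measurableT (ifwA _ h2) (ibV _ iV2)).
have e1 : \int[m1]_x h1f x = w + b * \int[m1]_x V x - \int[m1]_x f x.
  rewrite /h1f RintegralB//; [|exact: iwV|exact: if_].
  rewrite RintegralD//; [|exact: ic|exact: ibV].
  by rewrite Rintegral_cst1// RintegralZl.
have e2 : \int[m2]_x h2f x = \int[m2]_x f x - w + A + b * \int[m2]_x V x.
  rewrite /h2f RintegralD//; [|exact: ifwA|exact: ibV].
  rewrite RintegralD//; [|exact: ifw|exact: ic].
  rewrite RintegralB//; [|exact: if_|exact: ic].
  by rewrite !Rintegral_cst1// RintegralZl.
(* The truncations below divide by A. For A = 0 the claim is the sum of the two inequalities 0 <= E
   h1f and 0 <= E h2f. *)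
have [A00|Apos] := eqVneq A 0.
  have : 0 <= \int[m1]_x h1f x by apply: Rintegral_ge0.
  have : 0 <= \int[m2]_x h2f x by apply: Rintegral_ge0.
  by rewrite e1 e2 A00 mul0r; lra.
have {}Apos : 0 < A by rewrite lt_neqAle eq_sym Apos.
(* Setwise domination is available for [0, 1]-valued functions only, and nothing is known about V
   under k. Truncating h / A at 1 answers both, and the two truncations still add up to at least 1
   because h1f + h2f >= A. *)
have trunc (m : {measure set T -> \bar R}) (h : T -> R) : m setT = 1%E ->
    (forall B, measurable B -> (1 - a) * fine (k B) <= fine (m B)) ->
    measurable_fun setT h -> (forall x, 0 <= h x) ->
    m.-integrable setT (EFin \o h) ->
    (1 - a) * A * (\int[k]_x (Num.min (h x / A) 1)) <= \int[m]_x h x.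
  move=> hm km mh hh ih.
  pose g x := Num.min (h x / A) 1.
  have mg : measurable_fun setT g by apply: measurable_minr => //; exact: measurable_funM.
  have g01 x : 0 <= g x <= 1.
    by rewrite /g le_min ler01 divr_ge0//= ge_min lexx orbT.
  have ig : m.-integrable setT (EFin \o g).
    apply: (bounded_integrable hm mg (M := 1)) => x.
    by have /andP[? ?] := g01 x; rewrite ger0_norm.
  have : (1 - a) * \int[k]_x g x - \int[m]_x g x <= 0.
    apply: le_Rintegral_measure => //; first by lra.
    by move=> B mB; have := km _ mB; lra.
  rewrite subr_le0 => hh1.
  apply: (@le_trans _ _ (A * \int[m]_x g x)).
    by rewrite mulrAC [leLHS]mulrC ler_wpM2l.
  rewrite -RintegralZl//; apply: le_Rintegral => //.
    rewrite [X in _.-integrable _ X](_ : _ = fun x => (A%:E * (EFin \o g) x)%E)//.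
    exact: integrableZl.
  move=> x _; rewrite /g.
  rewrite (@le_trans _ _ (A * (h x / A)))//.
    by rewrite ler_wpM2l// ge_min lexx.
  by rewrite mulrCA divff ?mulr1// gt_eqF.
have t1 := trunc m1 h1f h1 km1 mh1 h10 ih1.
have t2 := trunc m2 h2f h2 km2 mh2 h20 ih2.
have : 1 <= \int[k]_x (Num.min (h1f x / A) 1) + \int[k]_x (Num.min (h2f x / A) 1).
  have bg (h : T -> R) : measurable_fun setT h -> (forall x, 0 <= h x) ->
      k.-integrable setT (EFin \o (fun x => Num.min (h x / A) 1)).
    move=> mh hh; apply: (bounded_integrable hk (M := 1)).
      by apply: measurable_minr => //; exact: measurable_funM.
    by move=> x; rewrite ger0_norm ?ge_min ?lexx ?orbT// le_min ler01 divr_ge0.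
  rewrite -RintegralD//; [|exact: bg|exact: bg].
  rewrite -[leLHS](Rintegral_cst1 1 hk); apply: le_Rintegral => //.
  - exact: ic.
  - exact: (integrableD measurableT (bg _ mh1 h10) (bg _ mh2 h20)).
  move=> x _; have := h12 x; rewrite -(ler_pM2r (x := A^-1)) ?invr_gt0//.
  rewrite divff ?gt_eqF// mulrDl.
  have : 0 <= h1f x / A by rewrite divr_ge0.
  have : 0 <= h2f x / A by rewrite divr_ge0.
  rewrite /Num.min; case: ifPn; case: ifPn; rewrite -?leNgt; lra.
set i1 := (X in 1 <= X + _); set i2 := (X in 1 <= _ + X) => i12.
have : (1 - a) * A <= (1 - a) * A * i1 + (1 - a) * A * i2.
  rewrite -mulrDr -[leLHS]mulr1 ler_wpM2l//.
  by rewrite mulr_ge0//; lra.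
move: t1 t2; rewrite -/i1 -/i2 e1 e2 mulrDr; lra.
Qed.

End bounded_functions.

(** * Measure-preserving maps *)

Section measure_preserving.
Context d (E : measurableType d) (R : realType) (mu : probability E R).
Variable T : E -> E.
Hypothesis mT : measurable_fun setT T.
Hypothesis muT : forall A, measurable A -> mu (T @^-1` A) = mu A.

Lemma measurable_iter n : measurable_fun setT (iter n T).
Proof.
elim: n => [|n IH]; first exact: measurable_id.
by rewrite [X in measurable_fun _ X](_ : _ = T \o iter n T)//; exact: measurableT_comp.
Qed.

Lemma Rintegral_preserving (f : E -> R) (M : R) : measurable_fun setT f ->
  (forall x, `|f x| <= M) -> \int[mu]_x f (T x) = \int[mu]_x f x.
Proof.
move=> mf fM; rewrite /Rintegral; congr fine.
have mfE : measurable_fun setT (EFin \o f) by exact/measurable_EFinP.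
have ifT : mu.-integrable (T @^-1` setT) ((EFin \o f) \o T).
  rewrite preimage_setT.
  apply: (bounded_integrable (probability_setT mu) (f := f \o T) (M := M)) => [|x].
    exact: measurableT_comp.
  exact: fM.
rewrite -[LHS](integral_pushforward mT mfE ifT measurableT).
by apply: eq_measure_integral => A mA _; rewrite /= /pushforward muT.
Qed.

Lemma Rintegral_preserving_iter n (f : E -> R) (M : R) : measurable_fun setT f ->
  (forall x, `|f x| <= M) -> \int[mu]_x f (iter n T x) = \int[mu]_x f x.
Proof.
move=> mf fM; elim: n => [//|n IH]; rewrite -[RHS]IH.
under eq_Rintegral do rewrite iterSr.
apply: (Rintegral_preserving (f := f \o iter n T) (M := M)).
  exact: measurableT_comp mf (measurable_iter n).
by move=> x; exact: fM.
Qed.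

Section product_along_orbit.
Variable rho : E -> R.
Hypothesis mrho : measurable_fun setT rho.
Hypothesis rho01 : forall x, 0 <= rho x <= 1.

Definition orbit_prod n (x : E) : R := \prod_(0 <= j < n) rho (iter j T x).

Lemma orbit_prod01 n x : 0 <= orbit_prod n x <= 1.
Proof.
rewrite /orbit_prod; apply/andP; split.
  by apply: prodr_ge0 => j _; have /andP[] := rho01 (iter j T x).
by apply: prodr_ile1 => j _; exact: rho01.
Qed.

Lemma orbit_prodS n x : orbit_prod n.+1 x = rho x * orbit_prod n (T x).
Proof.
rewrite /orbit_prod big_nat_recl//=; congr (_ * _).
by apply: eq_bigr => j _; rewrite -iterSr.
Qed.

Lemma orbit_prodSr n x : orbit_prod n.+1 x = orbit_prod n x * rho (iter n T x).
Proof. by rewrite /orbit_prod big_nat_recr. Qed.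

Lemma measurable_orbit_prod n : measurable_fun setT (orbit_prod n).
Proof.
elim: n => [|n IH].
  rewrite (_ : orbit_prod 0 = cst 1)//.
  by apply/funext => x; rewrite /orbit_prod big_nil.
rewrite (_ : orbit_prod n.+1 = fun x => orbit_prod n x * rho (iter n T x)).
  by apply: measurable_funM => //; exact: measurableT_comp mrho (measurable_iter n).
by apply/funext => x; rewrite orbit_prodSr.
Qed.

Let p1 : mu setT = 1%E. Proof. exact: probability_setT. Qed.

Let int01 (f : E -> R) : measurable_fun setT f -> (forall x, 0 <= f x <= 1) ->
  mu.-integrable setT (EFin \o f).
Proof.
move=> mf f01; apply: (bounded_integrable p1 mf (M := 1)) => x.
by have /andP[? ?] := f01 x; rewrite ger0_norm.
Qed.

(* Bernoulli's inequality 1 <= k (1 - x) + x ^ k with x = rho (T^n y) gives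
   E Z_n <= k (E Z_n - E Z_(n+1)) + E rho^k for the decreasing products Z_n. *)
Lemma cvg_orbit_prod : {ae mu, forall x, rho x < 1} ->
  \int[mu]_x orbit_prod n x @[n --> \oo] --> (0 : R).
Proof.
move=> rho1.
pose z n := \int[mu]_x orbit_prod n x.
have iz n := int01 (measurable_orbit_prod n) (orbit_prod01 n).
have zS n : z n.+1 <= z n.
  apply: le_Rintegral => // x _; rewrite orbit_prodSr.
  have /andP[? ?] := orbit_prod01 n x; have /andP[? ?] := rho01 (iter n T x).
  by rewrite ler_piMr.
have z0 n : 0 <= z n.
  by apply: Rintegral_ge0 => x _; have /andP[] := orbit_prod01 n x.
have mrk k : measurable_fun setT (fun x => rho x ^+ k) by exact: measurable_funX.
have rk01 k x : 0 <= rho x ^+ k <= 1.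
  by have /andP[? ?] := rho01 x; rewrite exprn_ge0//= exprn_ile1.
have key n k : z n <= k%:R * (z n - z n.+1) + \int[mu]_x (rho x ^+ k).
  have mri : measurable_fun setT (rho \o iter n T).
    exact: measurableT_comp mrho (measurable_iter n).
  rewrite -(Rintegral_preserving_iter n (M := 1) (mrk k)); last first.
    by move=> x; have /andP[? ?] := rk01 k x; rewrite ger0_norm.
  rewrite /z -RintegralB// -RintegralZl//; last first.
    exact: (integrableB measurableT (iz n) (iz n.+1)).
  have i1 : mu.-integrable setT
      (EFin \o (fun x => k%:R * (orbit_prod n x - orbit_prod n.+1 x))).
    rewrite [X in _.-integrable _ X](_ : _ = fun x =>
      (k%:R%:E * ((EFin \o orbit_prod n) \- (EFin \o orbit_prod n.+1)) x)%E)//.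
    by apply: integrableZl => //; exact: integrableB.
  have i2 : mu.-integrable setT (EFin \o (fun x => rho (iter n T x) ^+ k)).
    by apply: int01 => //; exact: measurableT_comp (mrk k) (measurable_iter n).
  rewrite -RintegralD//; apply: le_Rintegral => //.
    exact: (integrableD measurableT i1 i2).
  move=> x _; rewrite orbit_prodSr.
  have /andP[] := orbit_prod01 n x; have := rho01 (iter n T x).
  move: (rho _) (orbit_prod n x) => r y /andP[r0 r1] y0 y1.
  have : 1 - k%:R * (1 - r) <= r ^+ k.
    elim: k {i1 i2} => [|k IH]; first by rewrite mul0r subr0.
    rewrite exprS mulrSr.
    have k0 : 0 <= (k%:R : R) by exact: ler0n.
    have := ler_wpM2l r0 IH; have : 0 <= k%:R * ((1 - r) * (1 - r)).
      by rewrite !mulr_ge0// subr_ge0.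
    nra.
  have : 0 <= r ^+ k by exact: exprn_ge0.
  move: (r ^+ k) => s s0 sk.
  have : y * (1 - k%:R * (1 - r)) <= y * s by rewrite ler_wpM2l.
  have : y * s <= s by rewrite ler_piMl.
  by lra.
have zc : z @ \oo --> inf (range z).
  apply: nonincreasing_cvgn; first by apply/nonincreasing_seqP.
  by exists 0 => _ [n _ <-].
suff l0 : inf (range z) = 0 by rewrite -[in X in _ --> X]l0.
set l := inf (range z) in zc *.
have l0 : 0 <= l by apply: lb_le_inf; [exists (z 0%N), 0%N|move=> _ [n _ <-]].
apply/eqP; rewrite eq_le l0 andbT.
(* The order of limits matters: with k fixed, z n - z n.+1 vanishes as n grows; only then does k
   tend to infinity, where rho < 1 almost everywhere makes the mean of rho ^+ k vanish. *)
have lk k : l <= \int[mu]_x (rho x ^+ k).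
  have c2 : k%:R * (z n - z n.+1) + \int[mu]_x (rho x ^+ k) @[n --> \oo] -->
      k%:R * (l - l) + \int[mu]_x (rho x ^+ k).
    apply: cvgD; last exact: cvg_cst.
    apply: cvgM; first exact: cvg_cst.
    by apply: cvgB => //; rewrite cvg_shiftS.
  have := ler_cvg_to zc c2.
  by rewrite subrr mulr0 add0r; apply; exact: nearW.
have ck : \int[mu]_x (rho x ^+ k) @[k --> \oo] --> (\int[mu]_x 0 : R).
  apply: (bounded_cvg_Rintegral p1 (M := 1)) => //.
    by move=> n x; have /andP[? ?] := rk01 n x; rewrite ger0_norm.
  apply: filterS rho1 => x r1; apply: cvg_expr.
  by have /andP[? ?] := rho01 x; rewrite ger0_norm.
rewrite Rintegral_cst1// in ck.
by apply: cvgr_to_ge ck _; exact: nearW.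
Qed.

End product_along_orbit.

(** * The maximal inequality and the ergodic theorem for bounded functions *)

Section ergodic_averages.
Implicit Types f : E -> R.

Definition orbit_sum (f : E -> R) n (x : E) : R := \sum_(0 <= i < n) f (iter i T x).

Lemma orbit_sumS f n x : orbit_sum f n.+1 x = f x + orbit_sum f n (T x).
Proof.
rewrite /orbit_sum big_nat_recl//=; congr (_ + _).
by apply: eq_bigr => j _; rewrite -iterSr.
Qed.

Lemma measurable_orbit_sum f n : measurable_fun setT f ->
  measurable_fun setT (orbit_sum f n).
Proof.
move=> mf; apply: measurable_sum => i.
exact: measurableT_comp mf (measurable_iter i).
Qed.

Lemma orbit_sum_bounded f n x (M : R) : (forall x, `|f x| <= M) ->
  `|orbit_sum f n x| <= M *+ n.
Proof.
move=> fM; elim: n x => [|n IH] x; first by rewrite /orbit_sum big_nil normr0.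
by rewrite orbit_sumS mulrS (le_trans (ler_normD _ _))// lerD.
Qed.

Lemma orbit_sumN f n x : orbit_sum (fun z => - f z) n x = - orbit_sum f n x.
Proof. by rewrite /orbit_sum sumrN. Qed.

Lemma orbit_sumB_cst f (c : R) n x :
  orbit_sum (fun z => f z - c) n x = orbit_sum f n x - c *+ n.
Proof. by rewrite /orbit_sum sumrB sumr_const_nat subn0. Qed.

(* orbit_max f n is the maximum of the partial sums orbit_sum f k, k <= n. *)
Fixpoint orbit_max (f : E -> R) n (x : E) : R :=
  if n is n'.+1 then Num.max 0 (f x + orbit_max f n' (T x)) else 0.

Lemma orbit_max_ge0 f n x : 0 <= orbit_max f n x.
Proof. by case: n => //= n; rewrite le_max lexx. Qed.

Lemma orbit_maxS f n x : orbit_max f n x <= orbit_max f n.+1 x.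
Proof.
elim: n x => [|n IH] x; first exact: orbit_max_ge0.
have := IH (T x); rewrite [X in X <= _]/=; rewrite [orbit_max f n.+2 x]/= => h.
by rewrite ge_max !le_max lexx/= lerD2l h orbT.
Qed.

Lemma le_orbit_max f m n x : (m <= n)%N -> orbit_max f m x <= orbit_max f n x.
Proof.
by move/subnK <-; elim: (n - m)%N => // k IH; rewrite (le_trans IH)// orbit_maxS.
Qed.

Lemma orbit_sum_le_max f n x : orbit_sum f n x <= orbit_max f n x.
Proof.
elim: n x => [|n IH] x; first by rewrite /orbit_sum big_nil.
by rewrite orbit_sumS/= le_max lerD2l IH orbT.
Qed.

Lemma measurable_orbit_max f n : measurable_fun setT f ->
  measurable_fun setT (orbit_max f n).
Proof.
move=> mf; elim: n => [|n IH]; first exact: measurable_cst.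
apply: (measurable_maxr (f := cst 0) (g := fun x => f x + orbit_max f n (T x))) => //.
by apply: measurable_funD => //; exact: measurableT_comp.
Qed.

Lemma orbit_max_bounded f n x (M : R) : (forall x, `|f x| <= M) ->
  `|orbit_max f n x| <= M *+ n.
Proof.
move=> fM; elim: n x => [|n IH] x /=; first by rewrite normr0.
have M0 : 0 <= M by rewrite (le_trans _ (fM x)).
rewrite ger0_norm ?le_max ?lexx// ge_max mulrn_wge0//= mulrS.
apply: lerD; first by rewrite (le_trans (ler_norm _)).
by rewrite (le_trans (ler_norm _)).
Qed.

Let p1 : mu setT = 1%E. Proof. exact: probability_setT. Qed.

(** Garsia's argument. Let m be [orbit_max f n.+1]. Where m > 0, the recursion gives m <= f + m o T;
    elsewhere m = 0 <= m o T. So f restricted to {m > 0} dominates m - m o T, whose integral is 0 by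
    invariance, and these sets increase to a set of full measure. *)
Lemma maximal_ergodic f (M : R) : measurable_fun setT f ->
  (forall x, `|f x| <= M) -> {ae mu, forall x, exists n, 0 < orbit_sum f n x} ->
  0 <= \int[mu]_x f x.
Proof.
move=> mf fM fpos.
pose B n := [set x | 0 < orbit_max f n x].
have mB n : measurable (B n).
  by apply: measurable_lt_set => //; exact: measurable_orbit_max.
pose g n x := f x * \1_(B n) x.
have mg n : measurable_fun setT (g n).
  by apply: measurable_funM => //; exact: measurable_indic.
have gM n x : `|g n x| <= M.
  by rewrite /g indicE; case: (_ \in _); rewrite ?mulr1// mulr0 normr0 (le_trans _ (fM x)).
have g0 n : 0 <= \int[mu]_x g n.+1 x.
  have mm := measurable_orbit_max n.+1 mf.
  have mM x : `|orbit_max f n.+1 x| <= M *+ n.+1 by exact: orbit_max_bounded.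
  have mTM x : `|orbit_max f n.+1 (T x)| <= M *+ n.+1 by exact: orbit_max_bounded.
  have i1 := bounded_integrable p1 mm mM.
  have i2 : mu.-integrable setT (EFin \o (fun x => orbit_max f n.+1 (T x))).
    apply: (bounded_integrable p1) mTM.
    exact: (measurableT_comp (f := orbit_max f n.+1)).
  rewrite -[leLHS](subrr (\int[mu]_x orbit_max f n.+1 x)).
  rewrite -[in X in _ - X](Rintegral_preserving mm mM) -RintegralB//.
  apply: le_Rintegral => //.
  - exact: (integrableB measurableT i1 i2).
  - exact: bounded_integrable p1 (mg _) (gM _).
  move=> x _; rewrite /g indicE.
  have [|] := boolP (x \in B n.+1); rewrite ?inE ?notin_setE /B.
    move=> h; rewrite mulr1 lerBlDr.
    have := le_orbit_max f (T x) (leqnSn n).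
    move: h => /=; rewrite lt_max ltxx/= => h h2; rewrite max_r; last exact: ltW.
    by rewrite lerD2l.
  rewrite mulr0 => /negP; rewrite -leNgt => h.
  by rewrite subr_le0 (le_trans h)// orbit_max_ge0.
have c : \int[mu]_x g n.+1 x @[n --> \oo] --> \int[mu]_x f x.
  rewrite (cvg_shiftS (fun n => \int[mu]_x g n x)).
  apply: (bounded_cvg_Rintegral p1 mg mf gM).
  apply: filterS fpos => x [n n0].
  apply: cvg_near_cst; exists n => // k /= nk.
  rewrite /g indicE mem_set ?mulr1// /B/=.
  by rewrite (lt_le_trans n0)// (le_trans (orbit_sum_le_max f n x))// le_orbit_max.
by apply: cvgr_to_ge c _; exact: nearW.
Qed.

Hypothesis erg : forall A, measurable A -> T @^-1` A = A -> mu A = 0%E \/ mu A = 1%E.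

(** The set where some margin above c is exceeded infinitely often is invariant, hence null or of
    full measure. Full measure would give f - c a positive partial sum almost everywhere, and
    [maximal_ergodic] would force the mean of f to be at least c. *)
Lemma ergodic_limsup f (M c : R) : measurable_fun setT f ->
  (forall x, `|f x| <= M) -> \int[mu]_x f x < c ->
  {ae mu, forall x, forall k : nat, exists N, forall n, (N <= n)%N ->
    orbit_sum f n x <= (c + k.+1%:R^-1) *+ n}.
Proof.
move=> mf fM fc.
pose F k n := [set x | (c + k.+1%:R^-1) *+ n < orbit_sum f n x].
pose A := \bigcup_k lim_sup_set (F k).
have mF k n : measurable (F k n).
  by apply: measurable_lt_set => //; exact: measurable_orbit_sum.
have mA : measurable A.
  apply: bigcup_measurable => k _; apply: bigcap_measurable => // n _.
  by apply: bigcup_measurable => j _.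
have AP x : A x <-> exists k, forall m, exists2 n, (m <= n)%N & F k n x.
  split=> [[k _ h]|[k h]].
    by exists k => m; have [n /= mn Fn] := h m I; exists n.
  by exists k => // m _; have [n mn Fn] := h m; exists n.
have alg1 (e u s t : R) : 0 < e -> (c + e) * t < s -> c + e - u < e / 2 * t ->
    (c + e / 2) * (1 + t) < u + s.
  by move=> *; lra.
have alg2 (e u s t : R) : 0 < e -> (c + e) * (1 + t) < u + s ->
    u - c - e < e / 2 * t -> (c + e / 2) * t < s.
  by move=> *; lra.
have halfE k : ((k.*2.+1).+1%:R : R)^-1 = k.+1%:R^-1 / 2.
  by rewrite -invfM -natrM; congr (_%:R^-1); rewrite muln2 doubleS.
(* [erg] asks for exact invariance, which is why A is a union over all margins: passing between x
   and T x changes the sum by the single term f x and the length by one, and for large n half of the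
   margin absorbs this. The index k.*2.+1 is the one with margin half of 1 / (k + 1). *)
have TA : T @^-1` A = A.
  apply/seteqP; split => x /=.
    move=> /AP[k h]; apply/AP; exists k.*2.+1 => m.
    pose e : R := k.+1%:R^-1.
    have e0 : 0 < e by rewrite invr_gt0.
    pose m0 := Num.bound `|(c + e - f x) / (e / 2)|.
    have [n mn Fn] := h (maxn m m0); exists n.+1.
      by rewrite (leq_trans _ (leqnSn _))// (leq_trans _ mn)// leq_maxl.
    move: Fn; rewrite /F/= orbit_sumS halfE -/e => Fn.
    have : c + e - f x < e / 2 * n%:R.
      rewrite -ltr_pdivrMl ?divr_gt0// mulrC.
      apply: (lt_le_trans (lt_archi_bound _)).
      by rewrite ler_nat (leq_trans _ mn)// leq_maxr.
    move=> un; rewrite -[X in X < _]mulr_natr -[n.+1%:R]natr1 [n%:R + 1]addrC.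
    by apply: (alg1 e) => //; rewrite mulr_natr.
  move=> /AP[k h]; apply/AP; exists k.*2.+1 => m.
  pose e : R := k.+1%:R^-1.
  have e0 : 0 < e by rewrite invr_gt0.
  pose m0 := Num.bound `|(f x - c - e) / (e / 2)|.
  have [[|n] //] := h (maxn m m0).+1; rewrite ltnS => mn Fn.
  exists n; first by rewrite (leq_trans _ mn)// leq_maxl.
  move: Fn; rewrite /F/= orbit_sumS halfE -/e => Fn.
  have : f x - c - e < e / 2 * n%:R.
    rewrite -ltr_pdivrMl ?divr_gt0// mulrC.
    apply: (lt_le_trans (lt_archi_bound _)).
    by rewrite ler_nat (leq_trans _ mn)// leq_maxr.
  move=> un; rewrite -[X in X < _]mulr_natr.
  by apply: (alg2 e (f x)) => //; rewrite [1 + _]addrC natr1 mulr_natr.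
have muA0 : mu A = 0%E.
  have [//|muA1] := erg mA TA; exfalso.
  have : 0 <= \int[mu]_x (f x - c).
    apply: (maximal_ergodic (M := M + `|c|)).
    - exact: measurable_funB.
    - by move=> x; rewrite (le_trans (ler_normB _ _))// lerD2r.
    exists (~` A); split.
    + exact: measurableC.
    + by have := probability_setC mu mA; rewrite muA1 subee.
    move=> x /= nh Ax; apply: nh; have [k h] := (AP x).1 Ax.
    have [n n0 Fn] := h 1%N; exists n.
    rewrite orbit_sumB_cst subr_gt0; apply: lt_trans Fn.
    by rewrite ltr_pMn2r// ltrDl invr_gt0.
  rewrite RintegralB//; last 2 first.
  - exact: bounded_integrable p1 mf fM.
  - exact: (bounded_integrable p1 (M := `|c|)).
  by rewrite Rintegral_cst1// subr_ge0 leNgt fc.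
exists A; split => // x /= nh; apply: contrapT => nA; apply: nh => k.
apply: contrapT => nh; apply: nA; apply/AP; exists k => m.
apply: contrapT => nm; apply: nh; exists m => n mn.
by rewrite leNgt; apply/negP => Fn; apply: nm; exists n.
Qed.

Lemma birkhoff_ergodic f (M : R) : measurable_fun setT f ->
  (forall x, `|f x| <= M) ->
  {ae mu, forall x, orbit_sum f n x / n%:R @[n --> \oo] --> \int[mu]_x f x}.
Proof.
move=> mf fM; set l := \int[mu]_x f x.
have half (g : E -> R) (r : R) : measurable_fun setT g -> (forall x, `|g x| <= M) ->
    \int[mu]_x g x = r -> {ae mu, forall x, forall j : nat, exists N, forall n,
      (N <= n)%N -> orbit_sum g n x <= (r + 2 / j.+1%:R) *+ n}.
  move=> mg gM gr; apply/ae_foralln => j.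
  (* The threshold must lie strictly above the mean, which costs one 1 / (j + 1); the margin taken
     at index j costs the other. *)
  have := @ergodic_limsup g M (r + j.+1%:R^-1) mg gM.
  rewrite gr ltrDl invr_gt0 ltr0n => /(_ isT).
  apply: filterS => x /(_ j)[N h]; exists N => n /h.
  by rewrite mulr_natl mulr2n addrA.
have h1 := half f l mf fM erefl.
have mNf : measurable_fun setT (fun x => - f x) by exact: measurableT_comp.
have iN : \int[mu]_x (- f x) = - l.
  rewrite -[- l]mulN1r -RintegralZl//; last exact: bounded_integrable p1 mf fM.
  by apply: eq_Rintegral => x _; rewrite mulN1r.
have h2 : _ := half (fun x => - f x) (- l) mNf _ iN.
have {}h2 := h2 (fun x => (eq_ind_r (fun z => z <= M) (fM x) (normrN (f x)))).
apply: filterS2 h1 h2 => x h1 h2.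
apply/cvgrPdist_le => e e0.
pose j := Num.bound `|2 / e|.
have j2 : 2 / j.+1%:R <= e.
  rewrite ler_pdivrMr// -ler_pdivrMl// mulrC ltW//.
  apply: (lt_le_trans (lt_archi_bound _)); by rewrite ler_nat.
have [N1 H1] := h1 j; have [N2 H2] := h2 j.
exists (maxn (maxn N1 N2) 1) => // n /=; rewrite !geq_max -andbA => /and3P[n1 n2 n0].
have n0' : 0 < (n%:R : R) by rewrite ltr0n.
have := H1 n n1; have := H2 n n2; rewrite orbit_sumN.
rewrite -[X in _ <= X -> _]mulr_natr -[X in _ -> _ <= X -> _]mulr_natr.
rewrite -!ler_pdivrMr// mulNr => a1 a2.
by rewrite ler_norml; move: j2 a1 a2; move: (2 / _) (_ / n%:R) => u v *; apply/andP; split; lra.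
Qed.

Lemma ergodic_L1 f (M : R) : measurable_fun setT f ->
  (forall x, `|f x| <= M) ->
  \int[mu]_x `|orbit_sum f n x / n%:R - \int[mu]_x f x| @[n --> \oo] --> (0 : R).
Proof.
move=> mf fM; set l := \int[mu]_x f x.
have lM : `|l| <= M by exact: Rintegral_bounded.
rewrite -[X in _ --> X](Rintegral_cst1 0 p1).
apply: (bounded_cvg_Rintegral p1 (M := 2 * M)) => //.
- move=> n; apply: measurableT_comp => //; apply: measurable_funB => //.
  by apply: measurable_funM => //; exact: measurable_orbit_sum.
- move=> n x; rewrite normr_id (le_trans (ler_normB _ _))//.
  have [->|n0] := posnP n; first by have := normr_ge0 l; rewrite invr0 mulr0 normr0; lra.
  have n0' : 0 < (n%:R : R) by rewrite ltr0n.
  rewrite normrM normfV (ger0_norm (ltW n0')).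
  have : `|orbit_sum f n x| / n%:R <= M.
    by rewrite ler_pdivrMr// mulr_natr orbit_sum_bounded.
  by lra.
apply: filterS (birkhoff_ergodic mf fM) => x h.
by apply/norm_cvg0P; rewrite -[X in _ --> X](subrr l); apply: cvgB => //; exact: cvg_cst.
Qed.

End ergodic_averages.

End measure_preserving.

(** * Stationary environments *)

Section paths.
Context dY (Ysp : measurableType dY).

(** The generator of [path_measurable], so that measurability in [pathT] is the one in which
    stationarity and ergodicity are formulated. *)
Definition path_gen : set_system (int -> Ysp) :=
  \bigcup_(t in [set: int])
    preimage_set_system setT (fun y : int -> Ysp => y t) measurable.

Definition pathT := g_sigma_algebraType path_gen.

(** Steps of both signs: the weight looks backwards, while the chain and the ergodic averages
    iterate [shift_by 1]. *)
Definition shift_by (h : int) (y : pathT) : pathT := fun j => y (j + h).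

Lemma measurable_coord (t : int) : measurable_fun setT (fun y : pathT => y t : Ysp).
Proof.
move=> _ B mB; apply: sub_sigma_algebra; exists t => //; exists B => //.
Qed.

Lemma measurable_to_path d (T : measurableType d) (f : T -> pathT) :
  (forall t, measurable_fun setT (fun w => f w t : Ysp)) -> measurable_fun setT f.
Proof.
move=> mf; apply: (@measurability _ _ T pathT setT f path_gen) => //.
move=> _ [_ [t _ [B mB <-]] <-]; rewrite [X in measurable X](_ : _ = setT `&`
    (fun w => f w t) @^-1` B); last by apply/seteqP; split => w //= [_ []].
exact: mf.
Qed.

Lemma measurable_shift_by h : measurable_fun setT (shift_by h).
Proof. by apply: measurable_to_path => t; exact: measurable_coord. Qed.

Lemma shift_byD h k y : shift_by h (shift_by k y) = shift_by (h + k) y.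
Proof. by apply/funext => j; rewrite /shift_by addrA. Qed.

Lemma shift_by0 y : shift_by 0 y = y.
Proof. by apply/funext => j; rewrite /shift_by addr0. Qed.

Lemma iter_shift n y : iter n (shift_by 1) y = shift_by n%:Z y.
Proof.
elim: n => [|n IH]; first by rewrite shift_by0.
by rewrite iterS IH shift_byD intS.
Qed.

End paths.
Arguments measurable_coord {dY} Ysp t.
Arguments measurable_shift_by {dY} Ysp h.

(** * The random weight and the contraction rate *)

Section environment_weight.
Context (R : realType) dY (Ysp : measurableType dY).
Variables (gamma K alpha : Ysp -> R) (sigma eps : R).
Hypothesis mgamma : measurable_fun setT gamma.
Hypothesis mK : measurable_fun setT K.
Hypothesis malpha : measurable_fun setT alpha.
Hypothesis gamma_gt0 : forall y, 0 < gamma y.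
Hypothesis K_ge1 : forall y, 1 <= K y.
Hypothesis alpha01 : forall y, 0 <= alpha y < 1.
Hypothesis sigma_gt0 : 0 < sigma.
Hypothesis eps_gt0 : 0 < eps.
Hypothesis sigma_eps : sigma * (1 + eps) < 1.

Local Notation pathT := (pathT Ysp).
Local Notation T := (@shift_by _ Ysp 1).

Let K_gt0 y : 0 < K y. Proof. by rewrite (lt_le_trans ltr01). Qed.

(** A weight c' <= quota y satisfies alpha y + 2 c' K y <= (1 + alpha y) / 2 < 1: the additive
    constant of the drift, counted for two points, uses at most half of what the minorization
    gains. *)
Definition quota y : R := (1 - alpha y) / (4 * K y).

Lemma quota_gt0 y : 0 < quota y.
Proof.
have /andP[_ a1] := alpha01 y.
by rewrite divr_gt0 ?subr_gt0// mulr_gt0// ltr0n.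
Qed.

Lemma quota_le4 y : quota y * K y <= 4^-1.
Proof.
have /andP[a0 a1] := alpha01 y.
have -> : quota y * K y = (1 - alpha y) / 4.
  by rewrite /quota; field; rewrite gt_eqF.
by lra.
Qed.

(** The constraint that the quota at time -(k + 1) imposes on the present weight after being carried
    forward through k factors sigma / gamma. *)
Fixpoint past_weight k (y : pathT) : R :=
  if k is k'.+1 then sigma / gamma (y (-1)) * past_weight k' (shift_by (-1) y)
  else quota (y (-1)).

(* The largest c with c (T y) <= quota (y 0) and
   c (T y) gamma (y 0) <= sigma c y: the function c (y) V decays under the drift
   in every environment, and c > 0 almost surely is where the contractivity and
   smallness conditions enter. *)
Definition weight (y : pathT) : R := infs (fun k => past_weight k y) 0.

Lemma past_weight_gt0 k y : 0 < past_weight k y.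
Proof.
elim: k y => [|k IH] y /=; first exact: quota_gt0.
by rewrite mulr_gt0// divr_gt0.
Qed.

Let wset y := sdrop (fun k => past_weight k y) 0.

Let wset_lb y : has_lbound (wset y).
Proof. by exists 0 => _ [k _ <-]; exact/ltW/past_weight_gt0. Qed.

Let wset_n0 y : wset y !=set0.
Proof. by exists (past_weight 0 y); exists 0%N. Qed.

Lemma weight_le k y : weight y <= past_weight k y.
Proof. by apply: ge_inf; [exact: wset_lb|exists k]. Qed.

Lemma le_weight y c : (forall k, c <= past_weight k y) -> c <= weight y.
Proof. by move=> h; apply: lb_le_inf; [exact: wset_n0|move=> _ [k _ <-]]. Qed.

Lemma weight_ge0 y : 0 <= weight y.
Proof. by apply: le_weight => k; exact/ltW/past_weight_gt0. Qed.

Lemma weight_quota y : weight (T y) <= quota (y 0).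
Proof.
by rewrite (le_trans (weight_le 0 _))//= /shift_by addrC subrr.
Qed.

(** The constraint of index k.+1 at T y is sigma / gamma (y 0) times the constraint of index k at y,
    so the inequality passes to the infima. *)
Lemma weight_gamma y : weight (T y) * gamma (y 0) <= sigma * weight y.
Proof.
rewrite -ler_pdivrMl//; apply: le_weight => k.
have := weight_le k.+1 (T y).
rewrite /= shift_byD addNr shift_by0 {2}/shift_by addNr => h.
by rewrite ler_pdivrMl// -ler_pdivlMr// mulrAC.
Qed.

Lemma weight_le4 y : weight y <= 4^-1.
Proof.
rewrite (le_trans (weight_le 0 y))//=.
apply: le_trans (quota_le4 (y (-1))).
by rewrite ler_peMr// ltW// quota_gt0.
Qed.

Lemma weight_drift y v : 0 <= v ->
  weight (T y) * (gamma (y 0) * v + K (y 0)) <= sigma * weight y * v + 4^-1.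
Proof.
move=> v0; rewrite mulrDr lerD//.
  by rewrite mulrA ler_wpM2r// weight_gamma.
rewrite (le_trans _ (quota_le4 (y 0)))//.
by rewrite ler_wpM2r// ?weight_quota// ltW.
Qed.

Lemma measurable_past_weight k : measurable_fun setT (past_weight k).
Proof.
have mq : measurable_fun setT quota.
  apply: measurable_funM; first exact: measurable_funB.
  by apply: measurable_funV => [|y]; [exact: measurable_funM|rewrite mulr_ge0// ltW].
elim: k => [|k IH] /=.
  exact: measurableT_comp mq (measurable_coord _ (-1)).
apply: measurable_funM.
  apply: measurable_funM => //; apply: measurable_funV => [|y]; last exact: ltW.
  exact: measurableT_comp mgamma (measurable_coord _ (-1)).
exact: measurableT_comp IH (measurable_shift_by _ (-1)).
Qed.

Lemma measurable_weight : measurable_fun setT weight.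
Proof.
apply: measurable_fun_infs; last exact: measurable_past_weight.
by move=> y _; exists 0 => _ [k _ <-]; exact/ltW/past_weight_gt0.
Qed.

Definition small_radius (y : pathT) : R := 2 * K (y 0) / (eps * gamma (y 0)).

(* The second term is the supremum over W > small_radius y of
   (1 + sigma (1 + eps) c W) / (1 + c W), where c = weight y. *)
Definition rate (y : pathT) : R :=
  let u := weight y * small_radius y in
  Num.max ((1 + alpha (y 0)) / 2) ((1 + sigma * (1 + eps) * u) / (1 + u)).

Lemma small_radius_gt0 y : 0 < small_radius y.
Proof. by rewrite divr_gt0 ?mulr_gt0. Qed.

Let u0 y : 0 <= weight y * small_radius y.
Proof. by rewrite mulr_ge0 ?weight_ge0// ltW// small_radius_gt0. Qed.

Lemma rate01 y : 0 <= rate y <= 1.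
Proof.
have /andP[a0 a1] := alpha01 (y 0).
rewrite /rate le_max ge_max; apply/andP; split.
  by apply/orP; left; lra.
apply/andP; split; first lra.
have := u0 y; set u := _ * _ => uu; rewrite ler_pdivrMr; last lra.
by rewrite mul1r lerD2l ler_piMl// ltW.
Qed.

Lemma rate_lt1 y : 0 < weight y -> rate y < 1.
Proof.
move=> w0; have /andP[a0 a1] := alpha01 (y 0).
rewrite /rate gt_max; apply/andP; split; first lra.
have : 0 < weight y * small_radius y by rewrite mulr_gt0// small_radius_gt0.
set u := _ * _ => uu; rewrite ltr_pdivrMr; last lra.
by rewrite mul1r ltrD2l gtr_pMl.
Qed.

Lemma measurable_rate : measurable_fun setT rate.
Proof.
have c0 (f : Ysp -> R) : measurable_fun setT f ->
    measurable_fun setT (fun y : pathT => f (y 0)).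
  by move=> mf; exact: measurableT_comp mf (measurable_coord _ 0).
have mu_ : measurable_fun setT (fun y => weight y * small_radius y).
  apply: measurable_funM; first exact: measurable_weight.
  apply: measurable_funM; first by apply: measurable_funM => //; exact: c0.
  apply: measurable_funV => [|y]; last by rewrite mulr_ge0// ltW.
  by apply: measurable_funM => //; exact: c0.
apply: measurable_maxr.
  by apply: measurable_funM => //; apply: measurable_funD => //; exact: c0.
apply: measurable_funM.
  by apply: measurable_funD => //; exact: measurable_funM.
by apply: measurable_funV => [|y]; [exact: measurable_funD|rewrite addr_ge0].
Qed.

(** Here W stands for V x + V x', whence 2 K. The constant part is at most (1 + alpha) / 2, the
    first term of the rate; the part in W is multiplied by at most sigma, which lies below the
    second term. *)
Lemma rate_inside y W : 0 <= W ->
  alpha (y 0) + weight (T y) * (gamma (y 0) * W + 2 * K (y 0)) <=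
  rate y * (1 + weight y * W).
Proof.
move=> W0; have /andP[a0 a1] := alpha01 (y 0).
have r1 : (1 + alpha (y 0)) / 2 <= rate y by rewrite le_max lexx.
have se : sigma <= sigma * (1 + eps).
  by rewrite mulrDr mulr1 lerDl ltW// mulr_gt0.
have r2 : sigma <= rate y.
  rewrite le_max; apply/orP; right.
  have := u0 y; set u := _ * _ => uu; rewrite ler_pdivlMr; last lra.
  have : sigma <= sigma * (1 + eps) by [].
  have : sigma * u <= sigma * (1 + eps) * u by rewrite ler_wpM2r.
  by move: sigma_eps; move: (sigma * (1 + eps)) => s *; lra.
have cW : 0 <= weight y * W by rewrite mulr_ge0// weight_ge0.
have e1 : weight (T y) * (gamma (y 0) * W) <= sigma * (weight y * W).
  by rewrite !mulrA ler_wpM2r// weight_gamma.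
have e2 : weight (T y) * K (y 0) <= (1 - alpha (y 0)) / 4.
  rewrite (le_trans (y := quota (y 0) * K (y 0)))//.
    by rewrite ler_wpM2r ?weight_quota// ltW.
  rewrite /quota le_eqVlt; apply/orP; left; apply/eqP.
  by field; rewrite gt_eqF.
have e3 := ler_wpM2r cW r2.
by rewrite mulrDr mulrDr mulr1 mulrCA; lra.
Qed.

(** Beyond the radius, 2 K is at most eps gamma W, so the part in W is multiplied by s = sigma (1 +
    eps) < 1. The quotient (1 + s t) / (1 + t) decreases in t, hence is largest at the radius
    itself. *)
Lemma rate_outside y W : small_radius y < W ->
  1 + weight (T y) * (gamma (y 0) * W + 2 * K (y 0)) <=
  rate y * (1 + weight y * W).
Proof.
move=> RW; have R0 := small_radius_gt0 y.
have W0 : 0 < W by exact: lt_trans RW.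
have g0 := gamma_gt0 (y 0).
have KW : 2 * K (y 0) <= eps * (gamma (y 0) * W).
  move: RW; rewrite /small_radius ltr_pdivrMr ?mulr_gt0//.
  by rewrite (_ : W * _ = eps * (gamma (y 0) * W)) => [/ltW//|]; ring.
have cu : weight y * small_radius y <= weight y * W.
  by rewrite ler_wpM2l ?weight_ge0// ltW.
have e1 : weight (T y) * (gamma (y 0) * W + 2 * K (y 0)) <=
    sigma * (1 + eps) * (weight y * W).
  apply: (@le_trans _ _ (weight (T y) * gamma (y 0) * (1 + eps) * W)).
    rewrite -!mulrA ler_wpM2l ?weight_ge0//.
    by move: KW; lra.
  have /ler_wpM2r h := weight_gamma y.
  have eW : 0 <= (1 + eps) * W by rewrite ltW// mulr_gt0// addr_gt0.
  by have := h _ eW; rewrite !mulrA => /le_trans; apply; rewrite le_eqVlt;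
    apply/orP; left; apply/eqP; ring.
apply: le_trans (_ : 1 + sigma * (1 + eps) * (weight y * W) <= _).
  by rewrite lerD2l.
have cW : 0 <= weight y * W by rewrite mulr_ge0 ?weight_ge0// ltW.
have : (1 + sigma * (1 + eps) * (weight y * small_radius y)) /
    (1 + weight y * small_radius y) <= rate y by rewrite /rate le_max lexx orbT.
have uu := u0 y.
have h0 : 0 <= 1 + weight y * W by rewrite addr_ge0.
move=> /(ler_wpM2r h0); apply: le_trans.
rewrite [X in _ <= X]mulrAC ler_pdivlMr; last lra.
move: cu uu sigma_eps; move: (weight y * W) (weight y * small_radius y) (sigma * (1 + eps)).
move=> w u s uw u00 s1.
have : 0 <= (1 - s) * (w - u) by rewrite mulr_ge0//; lra.
by nra.
Qed.

(** Seen from the time of its quota, the constraint contains K (y 0) times the product of the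
    following gammas in its denominator, the very quantity of the contractivity condition.
    Stationarity lets its law be computed from there. *)
Lemma past_weight_shift k y : past_weight k (shift_by (k%:Z + 1) y) =
  quota (y 0) * \prod_(1 <= j < k.+1) (sigma / gamma (y j%:Z)).
Proof.
elim: k y => [|k IH] y /=.
  by rewrite big_geq// mulr1 /shift_by add0r addNr.
rewrite shift_byD intS [-1 + _]addrC -addrA addrC addrK IH.
rewrite [in RHS]big_nat_recr//= {1}/shift_by (_ : -1 + _ = k.+1%:Z); last first.
  by rewrite intS; ring.
by ring.
Qed.

Section positivity.
Variable PY : probability pathT R.
Hypothesis PYshift : forall h A, measurable A -> PY (shift_by h @^-1` A) = PY A.

Let gamma_prod k (y : pathT) := \prod_(1 <= j < k.+1) gamma (y j%:Z).

Let gamma_prod_gt0 k y : 0 < gamma_prod k y.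
Proof. by apply: prodr_gt0. Qed.

(** By Borel-Cantelli, only finitely many constraints fall below a fixed [del]. With s' < tau <
    sigma, Markov's inequality bounds the probability of K times the product of gammas reaching tau
    ^+ k by (s' / tau) ^+ k. Otherwise there is a surplus L ^+ k = (sigma / tau) ^+ k, which may be
    spent on a small 1 - alpha. Since L ^+ k is exponentially large, a power bound on the moments of
    alpha already gives geometric decay. *)
Lemma weight_gt0 (s' theta : R) (N0 : nat) : 0 < s' < sigma -> 0 < theta ->
  (forall k, (N0 <= k)%N ->
    (\int[PY]_y (K (y 0) * \prod_(1 <= j < k.+1) gamma (y j%:Z))%:E
      <= (s' ^+ k)%:E)%E) ->
  (forall n, (N0 <= n)%N ->
    (\int[PY]_y (alpha (y 0) ^+ n)%:E <= ((n%:R `^ theta)^-1)%:E)%E) ->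
  {ae PY, forall y, 0 < weight y}.
Proof.
move=> /andP[s'0 s's] theta0 Hgamma Halpha.
pose tau := (s' + sigma) / 2.
have tau0 : 0 < tau by rewrite /tau; lra.
have s'tau : s' < tau by rewrite /tau; lra.
have tausigma : tau < sigma by rewrite /tau; lra.
pose L := sigma / tau.
have L1 : 1 < L by rewrite ltr_pdivlMr// mul1r.
have L0 : 0 < L by exact: lt_trans L1.
(* An integer comparable to L ^+ k; adding N0 puts it in the range where the moment bound on alpha
   holds. *)
pose n_ k := ((Num.truncn (L ^+ k)).+1 + N0)%N.
have Ln k : L ^+ k <= (n_ k)%:R.
  rewrite natrD (le_trans (ltW (truncnS_gt _)))// lerDl.
  exact: ler0n.
have nL k : (n_ k)%:R <= (2 + N0%:R) * L ^+ k.
  have Lk1 : 1 <= L ^+ k by apply: exprn_ege1; exact: ltW.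
  have : (Num.truncn (L ^+ k))%:R <= L ^+ k.
    by rewrite truncn_le (le_trans ler01 Lk1).
  rewrite /n_ natrD -natr1.
  have : N0%:R <= N0%:R * L ^+ k by rewrite ler_peMr.
  by lra.
have n0 k : 0 < (n_ k)%:R :> R by rewrite ltr0n.
(* The factor 4 of the quota times the bound 2 (2 + N0) L ^+ k on 2 n_ k, once L ^+ k is cancelled
   by the surplus. *)
pose del : R := (8 * (2 + N0%:R))^-1.
have N00 : 0 <= (N0%:R : R) by exact: ler0n.
have del0 : 0 < del by rewrite invr_gt0; lra.
pose r1 := s' / tau.
pose r2 := (L `^ theta)^-1.
have r10 : 0 <= r1 by rewrite divr_ge0 ?ltW.
have r11 : r1 < 1 by rewrite ltr_pdivrMr// mul1r.
have Lt1 : 1 < L `^ theta.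
  have : 1 `^ theta < L `^ theta by rewrite gt0_ltr_powR// nnegrE ?ler01// ltW.
  by rewrite powR1.
have r20 : 0 <= r2 by rewrite invr_ge0 powR_ge0.
have r21 : r2 < 1 by rewrite invf_lt1// (lt_trans ltr01).
pose B k := [set y | past_weight k y < del].
have mpw k : measurable_fun setT (past_weight k) by exact: measurable_past_weight.
have mB k : measurable (B k) by exact: measurable_lt_set.
have mg0 k : measurable_fun setT (fun y : pathT => K (y 0) * gamma_prod k y).
  apply: measurable_funM.
    exact: measurableT_comp mK (measurable_coord _ 0).
  apply: measurable_prod => j _.
  exact: measurableT_comp mgamma (measurable_coord _ j%:Z).
have ma0 n : measurable_fun setT (fun y : pathT => alpha (y 0) ^+ n).
  apply: measurable_funX; exact: measurableT_comp malpha (measurable_coord _ 0).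
have incl k : shift_by (k%:Z + 1) @^-1` B k `<=`
    [set y | tau ^+ k <= K (y 0) * gamma_prod k y] `|`
    [set y | 2^-1 <= alpha (y 0) ^+ n_ k].
  move=> y; rewrite /B/= past_weight_shift// => h.
  have [|h1] := leP (tau ^+ k) (K (y 0) * gamma_prod k y); first by left.
  right; rewrite leNgt; apply/negP => h2; move: h; apply/negP; rewrite -leNgt.
  have /andP[a0 a1] := alpha01 (y 0).
  have an : alpha (y 0) <= 1 - (2 * (n_ k)%:R)^-1.
    (* If alpha exceeded 1 - 1 / (2 n), Bernoulli's inequality would give alpha ^+ n >= 1 / 2. *)
    rewrite leNgt; apply/negP => h3; move: h2; apply/negP; rewrite -leNgt.
    pose x : R := (2 * (n_ k)%:R)^-1.
    have xn : x * (n_ k)%:R = 2^-1 by rewrite /x; field; rewrite gt_eqF.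
    have x0 : 0 < x by rewrite invr_gt0 mulr_gt0.
    have x2 : x <= 2^-1 by rewrite -xn ler_peMr ?(ltW x0)// ler1n.
    have bern m : 1 - x * m%:R <= alpha (y 0) ^+ m.
      elim: m => [|m IH]; first by rewrite mulr0 subr0.
      have [xm|xm] := leP (1 - x * m.+1%:R) 0.
        by rewrite (le_trans xm)// exprn_ge0.
      rewrite exprS; apply: (@le_trans _ _ ((1 - x) * (1 - x * m%:R))).
        rewrite -natr1; have : 0 <= x * (x * m%:R) by rewrite !mulr_ge0// ltW.
        by lra.
      apply: ler_pM => //; last exact: ltW.
        by lra.
      by move: xm; rewrite -natr1; lra.
    by have := bern (n_ k); rewrite xn; lra.
  have q1 : (1 - alpha (y 0)) * (2 * ((2 + N0%:R) * L ^+ k)) >= 1.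
    apply: (@le_trans _ _ ((1 - alpha (y 0)) * (2 * (n_ k)%:R))).
      rewrite -ler_pdivrMr ?mulr_gt0// mul1r; lra.
    by rewrite ler_wpM2l ?subr_ge0 ?(ltW a1)// ler_wpM2l.
  rewrite prodf_div prodr_const_nat subn1/=.
  rewrite /quota -/(gamma_prod k y) mulf_div ler_pdivlMr; last first.
    by rewrite !mulr_gt0.
  have sE : sigma ^+ k = L ^+ k * tau ^+ k.
    by rewrite -exprMn /L divfK// gt_eqF.
  rewrite sE /del; set G := gamma_prod k y in h1 *.
  have t0 : 0 < tau ^+ k by rewrite exprn_gt0.
  have Lk0 : 0 < L ^+ k by rewrite exprn_gt0.
  rewrite -(ler_pM2l (x := 2 * (2 + N0%:R))); last lra.
  apply: (@le_trans _ _ (tau ^+ k)).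
    have eKG : 2 * (2 + N0%:R) * ((8 * (2 + N0%:R))^-1 * (4 * K (y 0) * G)) =
      K (y 0) * G by field; lra.
    by rewrite eKG ltW.
  rewrite -[leLHS]mul1r (_ : 2 * (2 + N0%:R) * _ =
    (1 - alpha (y 0)) * (2 * ((2 + N0%:R) * L ^+ k)) * tau ^+ k); last by ring.
  by rewrite ler_wpM2r// ltW.
have PB k : (N0 <= k)%N -> (PY (B k) <= (r1 ^+ k + 2 * r2 ^+ k)%:E)%E.
  move=> Nk; rewrite -(PYshift (k%:Z + 1) (mB k)).
  have mA1 : measurable [set y : pathT | tau ^+ k <= K (y 0) * gamma_prod k y].
    rewrite -[X in measurable X]setTI.
    by apply: (measurable_fun_le (f := cst (tau ^+ k))).
  have mA2 : measurable [set y : pathT | 2^-1 <= alpha (y 0) ^+ n_ k].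
    rewrite -[X in measurable X]setTI.
    by apply: (measurable_fun_le (f := cst 2^-1)).
  have mS : measurable (shift_by (k%:Z + 1) @^-1` B k).
    by rewrite -[X in measurable X]setTI; exact: measurable_shift_by.
  apply: le_trans (le_measure _ _ _ (incl k)) _; rewrite ?inE//.
    exact: measurableU.
  apply: le_trans (measureU2 _ mA1 mA2) _; rewrite EFinD leeD//.
    have t0 : 0 < tau ^+ k by rewrite exprn_gt0.
    have := markov_set PY (mg0 k) (fun y => ltW (mulr_gt0 (K_gt0 _) (gamma_prod_gt0 k y))) t0.
    move=> /le_trans /(_ (Hgamma k Nk)).
    have r1E : r1 ^+ k = (tau ^+ k)^-1 * s' ^+ k by rewrite /r1 expr_div_n mulrC.
    by rewrite -lee_pdivlMl// -EFinM r1E.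
  have h0 : 0 < (2^-1 : R) by lra.
  have aa (y : pathT) : 0 <= alpha (y 0) ^+ n_ k.
    by have /andP[? _] := alpha01 (y 0); rewrite exprn_ge0.
  have := markov_set PY (ma0 (n_ k)) aa h0.
  move=> /le_trans /(_ (Halpha _ (leq_addl _ _))).
  rewrite -lee_pdivlMl// -EFinM invrK => /le_trans; apply.
  rewrite lee_fin ler_wpM2l// /r2 exprVn lef_pV2 ?posrE ?powR_gt0//; last first.
    by rewrite exprn_gt0// powR_gt0.
  have -> : (L `^ theta) ^+ k = (L ^+ k) `^ theta.
    by rewrite -[LHS]powR_mulrn ?powR_ge0// -(powR_mulrn k (ltW L0)) -!powRrM mulrC.
  by rewrite ge0_ler_powR ?nnegrE ?(ltW theta0)// exprn_ge0// ltW.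
pose F k := B (k + N0)%N.
have Fsum : (\sum_(k <oo) PY (F k) < +oo)%E.
  pose r := Num.max r1 r2.
  apply: (@nneseries_geometric_lty _ _ 3 r) => //.
  - by rewrite le_max r10.
  - by rewrite gt_max r11.
  move=> k; apply: le_trans (PB _ (leq_addl _ _)) _; rewrite lee_fin.
  have a1 : r1 ^+ (k + N0) <= r ^+ k.
    rewrite exprD (@le_trans _ _ (r1 ^+ k))//.
      by rewrite ler_piMr ?exprn_ge0// exprn_ile1// ltW.
    by rewrite lerXn2r ?nnegrE ?le_max ?r10 ?lexx.
  have a2 : r2 ^+ (k + N0) <= r ^+ k.
    rewrite exprD (@le_trans _ _ (r2 ^+ k))//.
      by rewrite ler_piMr ?exprn_ge0// exprn_ile1// ltW.
    by rewrite lerXn2r ?nnegrE ?le_max ?r10 ?r20 ?lexx ?orbT.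
  by lra.
exists (lim_sup_set F); split.
- by apply: bigcap_measurable => // n _; apply: bigcup_measurable => j _; exact: mB.
- by apply: lim_sup_set_cvg0 => // k; exact: mB.
move=> y /= nh; apply: contrapT => nF; apply: nh.
have [m hm] : exists m, forall k, (m <= k)%N -> del <= past_weight k y.
  apply: contrapT => nm; apply: nF => n _; apply: contrapT => nn; apply: nm.
  exists (n + N0)%N => k nk; rewrite leNgt; apply/negP => kd; apply: nn.
  have N0k : (N0 <= k)%N by rewrite (leq_trans _ nk)// leq_addl.
  exists (k - N0)%N; first by rewrite /= leq_subRL// addnC.
  by rewrite /F/B/= subnK.
(* The finitely many remaining constraints are positive, so they keep the infimum away from 0 as
   well. *)
have [e e0 he] : exists2 e : R, 0 < e & forall k, (k < m)%N -> e <= past_weight k y.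
  elim: m {hm} => [|m [e e0 he]]; first by exists 1.
  exists (Num.min e (past_weight m y)); first by rewrite lt_min e0 past_weight_gt0.
  move=> k; rewrite ltnS leq_eqVlt => /predU1P[->|km].
    by rewrite ge_min lexx orbT.
  by rewrite ge_min he.
apply: (@lt_le_trans _ _ (Num.min del e)); first by rewrite lt_min del0.
apply: le_weight => k; have [km|mk] := ltnP k m.
  by rewrite ge_min he ?orbT.
by rewrite ge_min hm.
Qed.

End positivity.

End environment_weight.

(** * Contraction in a fixed environment *)

Section kernel_composition.
Context (R : realType) dA dB dZ (A : measurableType dA) (B : measurableType dB)
  (Z : measurableType dZ).
Variables (k : R.-pker B ~> Z) (f : A -> B) (mf : measurable_fun setT f).

(** The measurability proof is an argument so that the kernel structure can be inferred from the
    term. *)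
Definition kpre (_ : measurable_fun setT f) : A -> {measure set Z -> \bar R} :=
  fun a => k (f a).

Let measurable_kpre U : measurable U -> measurable_fun setT ((kpre mf) ^~ U).
Proof. by move=> mU; exact: measurableT_comp (measurable_kernel k U mU) mf. Qed.

HB.instance Definition _ := isKernel.Build _ _ _ _ _ (kpre mf) measurable_kpre.

Let kpre_prob a : kpre mf a setT = 1%E.
Proof. exact: prob_kernel. Qed.

HB.instance Definition _ := Kernel_isProbability.Build _ _ _ _ _ (kpre mf) kpre_prob.

Lemma measurable_Rintegral_kernel (F : A * Z -> R) (M : R) :
  measurable_fun setT F -> (forall p, `|F p| <= M) ->
  measurable_fun setT (fun a => \int[k (f a)]_z F (a, z)).
Proof.
move=> mF FM.
have mFa a : measurable_fun setT (fun z => F (a, z)).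
  exact: measurableT_comp mF (measurable_pair1 a).
have p1 a : k (f a) setT = 1%E by exact: prob_kernel.
(* Adding M makes the integrand nonnegative, the setting in which kernel integrals are known to be
   measurable. *)
rewrite (_ : (fun a => _) = fun a => fine (\int[kpre mf a]_z (F (a, z) + M)%:E)%E - M).
  apply: measurable_funB => //; apply: measurableT_comp => //.
  apply: (measurable_fun_integral_finite_kernel (fun p => (F p + M)%:E) (kpre mf)).
    by move=> p; rewrite lee_fin; have := FM p; rewrite ler_norml => /andP[]; lra.
  by apply/measurable_EFinP; exact: measurable_funD.
apply/funext => a; rewrite -/(Rintegral (kpre mf a) setT (fun z => F (a, z) + M)).
rewrite RintegralD//; last 2 first.
- exact: (bounded_integrable (p1 a) (mFa a) (fun z => FM (a, z))).
- exact: (bounded_integrable (p1 a) (M := `|M|)).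
by rewrite Rintegral_cst1 ?addrK.
Qed.

End kernel_composition.

(** * Iterated kernels along a fixed environment *)

Section chain_operator.
Context (R : realType) dX dY (Xsp : measurableType dX) (Ysp : measurableType dY).
Variable Q : R.-pker (Ysp * Xsp)%type ~> Xsp.
Implicit Types (f g : Xsp -> R) (M N : R).

Local Notation pathT := (pathT Ysp).
Local Notation T := (@shift_by _ Ysp 1).

Let Q1 p : Q p setT = 1%E. Proof. exact: prob_kernel. Qed.

(* Q (y 0) Q (y 1) ... Q (y (n - 1)) f. *)
Fixpoint chain_op n (f : Xsp -> R) (y : pathT) (x : Xsp) : R :=
  if n is n'.+1 then \int[Q (y 0, x)]_z chain_op n' f (T y) z else f x.

Let mstate : measurable_fun setT (fun p : pathT * Xsp => (p.1 0 : Ysp, p.2)).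
Proof.
apply: measurable_fun_pair; last exact: measurable_snd.
exact: measurableT_comp (measurable_coord _ 0) measurable_fst.
Qed.

Lemma measurable_bounded_chain_op n f M : measurable_fun setT f ->
  (forall x, `|f x| <= M) ->
  measurable_fun setT (fun p : pathT * Xsp => chain_op n f p.1 p.2) /\
  forall y x, `|chain_op n f y x| <= M.
Proof.
move=> mf fM; elim: n => [|n [mn nM]] /=.
  by split=> //; exact: measurableT_comp mf measurable_snd.
have mT : measurable_fun setT (fun p : (pathT * Xsp) * Xsp => (T p.1.1, p.2)).
  apply: measurable_fun_pair; last exact: measurable_snd.
  apply: measurableT_comp; first exact: measurable_shift_by.
  exact: measurableT_comp measurable_fst measurable_fst.
split=> [|y x].
  apply: (measurable_Rintegral_kernel Q mstate
    (F := fun p : (pathT * Xsp) * Xsp => chain_op n f (T p.1.1) p.2) (M := M)).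
    exact: (measurableT_comp mn mT).
  by move=> p; exact: nM.
apply: (Rintegral_bounded (Q1 _)) => //.
exact: (measurableT_comp mn (measurable_pair1 (T y))).
Qed.

Section bounded_observable.
Variables (f : Xsp -> R) (M : R).
Hypothesis mf : measurable_fun setT f.
Hypothesis fM : forall x, `|f x| <= M.

Lemma measurable_chain_op n :
  measurable_fun setT (fun p : pathT * Xsp => chain_op n f p.1 p.2).
Proof. by case: (measurable_bounded_chain_op n mf fM). Qed.

Lemma chain_op_bounded n y x : `|chain_op n f y x| <= M.
Proof. by case: (measurable_bounded_chain_op n mf fM). Qed.

Lemma measurable_chain_op1 n x : measurable_fun setT (fun y => chain_op n f y x).
Proof. exact: (measurableT_comp (measurable_chain_op n) (measurable_pair2 x)). Qed.

Lemma measurable_chain_op2 n y : measurable_fun setT (chain_op n f y).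
Proof. exact: (measurableT_comp (measurable_chain_op n) (measurable_pair1 y)). Qed.

Lemma integrable_chain_op n y p :
  (Q p).-integrable setT (EFin \o chain_op n f y).
Proof.
exact: bounded_integrable (Q1 _) (measurable_chain_op2 n y) (chain_op_bounded n y).
Qed.

End bounded_observable.

Lemma chain_opD n f g M N y x : measurable_fun setT f -> measurable_fun setT g ->
  (forall x, `|f x| <= M) -> (forall x, `|g x| <= N) ->
  chain_op n (fun x => f x + g x) y x = chain_op n f y x + chain_op n g y x.
Proof.
move=> mf mg fM gN; elim: n y x => [//|n IH] y x /=.
rewrite -RintegralD//; last 2 first.
- exact: (integrable_chain_op mf fM).
- exact: (integrable_chain_op mg gN).
by apply: eq_Rintegral => z _; rewrite IH.
Qed.

Lemma chain_op_cst n c y x : chain_op n (cst c) y x = c.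
Proof.
elim: n y x => [//|n IH] y x /=; under eq_Rintegral do rewrite IH.
exact: Rintegral_cst1.
Qed.

Lemma chain_op_ge0 n f y x : (forall x, 0 <= f x) -> 0 <= chain_op n f y x.
Proof. by move=> f0; elim: n y x => [//|n IH] y x /=; exact: Rintegral_ge0. Qed.

Lemma chain_op_cvg n (f_ : nat -> Xsp -> R) f M y x :
  (forall k, measurable_fun setT (f_ k)) -> measurable_fun setT f ->
  (forall k x, `|f_ k x| <= M) -> (forall x, `|f x| <= M) ->
  (forall x, f_ ^~ x @ \oo --> f x) ->
  chain_op n (f_ k) y x @[k --> \oo] --> chain_op n f y x.
Proof.
move=> mf_ mf f_M fM cf; elim: n y x => [|n IH] y x /=; first exact: cf.
apply: (bounded_cvg_Rintegral (Q1 _) (M := M)).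
- by move=> k; exact: measurable_chain_op2 (mf_ k) (f_M k) n _.
- exact: measurable_chain_op2 mf fM n _.
- by move=> k z; exact: chain_op_bounded (mf_ k) (f_M k) n _ _.
- by apply: aeW => z; exact: IH.
Qed.

Section contraction.
Variables (V : Xsp -> R) (gamma K alpha radius : Ysp -> R).
Variables (kappa : R.-pker Ysp ~> Xsp) (w rho : pathT -> R) (sigma : R).
Hypothesis V_ge0 : forall x, 0 <= V x.
Hypothesis iV : forall p, (Q p).-integrable setT (EFin \o V).
Hypothesis QV : forall y x, \int[Q (y, x)]_z V z <= gamma y * V x + K y.
Hypothesis alpha01 : forall y, 0 <= alpha y < 1.
Hypothesis minor : forall y x A, measurable A -> V x <= radius y ->
  (1 - alpha y) * fine (kappa y A) <= fine (Q (y, x) A).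
Hypothesis w_ge0 : forall y, 0 <= w y.
Hypothesis w_le1 : forall y, w y <= 1.
Hypothesis rho01 : forall y, 0 <= rho y <= 1.
Hypothesis sigma01 : 0 < sigma < 1.
Hypothesis w_drift : forall y v, 0 <= v ->
  w (T y) * (gamma (y 0) * v + K (y 0)) <= sigma * w y * v + 4^-1.
Hypothesis inside : forall y W, 0 <= W ->
  alpha (y 0) + w (T y) * (gamma (y 0) * W + 2 * K (y 0)) <= rho y * (1 + w y * W).
Hypothesis outside : forall y W, radius (y 0) < W ->
  1 + w (T y) * (gamma (y 0) * W + 2 * K (y 0)) <= rho y * (1 + w y * W).

Local Notation prodr := (orbit_prod T rho).

(** The induction hypothesis at T y bounds the oscillation of [chain_op n f (T y)] in the form A + b
    (V z + V z') required by [minorized_contraction], with b = A w (T y). That lemma followed by the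
    drift leaves A times the left side of [inside] or [outside], which gains the factor rho y. *)
Lemma chain_op_contraction n f M y x x' : measurable_fun setT f ->
  (forall x, `|f x| <= M) ->
  `|chain_op n f y x - chain_op n f y x'| <=
    2 * M * prodr n y * (1 + w y * (V x + V x')).
Proof.
move=> mf fM.
have M0 : 0 <= M by exact: le_trans (fM point).
elim: n y x x' => [|n IH] y x x'.
  rewrite /= /orbit_prod big_nil mulr1.
  apply: (@le_trans _ _ (2 * M)).
    rewrite (le_trans (ler_normB _ _))//.
    by have := fM x; have := fM x'; lra.
  by rewrite ler_peMr ?mulr_ge0// lerDl mulr_ge0// addr_ge0.
set A := 2 * M * prodr n (T y).
have A0 : 0 <= A.
  by rewrite !mulr_ge0//; have /andP[] := orbit_prod01 T rho01 n (T y).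
set W := V x + V x'; have W0 : 0 <= W by rewrite addr_ge0.
(* One argument for both regimes: a = alpha (y 0) when V x + V x' is within the radius, so that both
   points lie in the small set, and a = 1 otherwise, where the minorization is void and the drift
   alone contracts. Leaving u and u' free gives both signs of the absolute value. *)
suff main a u u' : 0 <= a <= 1 ->
    (forall B, measurable B -> (1 - a) * fine (kappa (y 0) B) <= fine (Q (y 0, u) B)) ->
    (forall B, measurable B -> (1 - a) * fine (kappa (y 0) B) <= fine (Q (y 0, u') B)) ->
    V u + V u' = W ->
    a + w (T y) * (gamma (y 0) * W + 2 * K (y 0)) <= rho y * (1 + w y * W) ->
    chain_op n.+1 f y u - chain_op n.+1 f y u' <=
      2 * M * prodr n.+1 y * (1 + w y * W).
  have [Wr|rW] := leP W (radius (y 0)).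
    have /andP[a0 a1] := alpha01 (y 0).
    have aa : 0 <= alpha (y 0) <= 1 by rewrite a0 ltW.
    have vx : V x <= radius (y 0) by rewrite (le_trans _ Wr)// lerDl.
    have vx' : V x' <= radius (y 0) by rewrite (le_trans _ Wr)// lerDr.
    have ins := inside y W0.
    rewrite ler_norml lerNl opprB; apply/andP; split.
      by apply: (main _ _ _ aa) => // [B mB|B mB|]; [exact: minor..|rewrite addrC].
    by apply: (main _ _ _ aa) => // B mB; exact: minor.
  have out := outside rW.
  have a01 : 0 <= (1 : R) <= 1 by rewrite ler01 lexx.
  have triv u B : measurable B -> (1 - 1) * fine (kappa (y 0) B) <= fine (Q (y 0, u) B).
    by move=> _; rewrite subrr mul0r fine_ge0.
  rewrite ler_norml lerNl opprB; apply/andP; split.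
    by apply: (main 1 x' x a01); [exact: triv|exact: triv|rewrite addrC|exact: out].
  exact: (main 1 x x' a01 (triv _) (triv _) erefl out).
move=> a01 ku ku' uW aW /=.
have := @minorized_contraction _ _ _ (Q (y 0, u)) (Q (y 0, u')) (kappa (y 0)) V
  (chain_op n f (T y)) A (A * w (T y)) a M (Q1 _) (Q1 _) (prob_kernel _) a01 A0
  (mulr_ge0 A0 (w_ge0 _)) ku ku' V_ge0 (iV _) (iV _)
  (measurable_chain_op2 mf fM n (T y)) (chain_op_bounded mf fM n (T y)).
have h z z' : `|chain_op n f (T y) z - chain_op n f (T y) z'| <=
    A + A * w (T y) * (V z + V z').
  by rewrite -mulrA -{1}[A]mulr1 -mulrDr; exact: IH.
move=> /(_ h) /le_trans; apply.
rewrite -mulrA -mulrDr orbit_prodS.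
rewrite (_ : 2 * M * (_ * _) * _ = A * (rho y * (1 + w y * W))); last by rewrite /A; ring.
apply: ler_wpM2l => //; apply: le_trans aW; rewrite lerD2l ler_wpM2l//.
by have := QV (y 0) u; have := QV (y 0) u'; rewrite -uW; lra.
Qed.

Let B0 : R := (4 * (1 - sigma))^-1.

Definition tightness_cst : R := B0.

Lemma tightness_cst_ge0 : 0 <= tightness_cst.
Proof. by have /andP[? ?] := sigma01; rewrite invr_ge0; lra. Qed.

(* The bound on w (T^l y) E V (X_l), conditionally on the environment, is
   sigma^l w y V x + B (1 - sigma^l) with B = 1 / (4 (1 - sigma)). *)
Let chain_op_shift_aux l n f M y x x0 : measurable_fun setT f ->
  (forall x, `|f x| <= M) ->
  `|chain_op (l + n) f y x - chain_op n f (iter l T y) x0| <=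
    2 * M * prodr n (iter l T y) * (1 + w (iter l T y) * V x0 +
       B0 * (1 - sigma ^+ l) + sigma ^+ l * w y * V x).
Proof.
move=> mf fM; have /andP[s0 s1] := sigma01.
have M0 : 0 <= M by exact: le_trans (fM point).
elim: l y x => [|l IH] y x.
  rewrite add0n expr0 subrr mulr0 addr0 mul1r /=.
  by apply: le_trans (chain_op_contraction _ _ _ _ mf fM) _; rewrite mulrDr; lra.
rewrite iterSr addSn /=.
set c := chain_op n f _ x0; set P := 2 * M * prodr n _.
have P0 : 0 <= P.
  by rewrite !mulr_ge0//; have /andP[] := orbit_prod01 T rho01 n (iter l T (T y)).
set wx := w _ * V x0.
pose C0 := P * (1 + wx + B0 * (1 - sigma ^+ l)).
pose C1 := P * (sigma ^+ l * w (T y)).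
have mc := measurable_chain_op2 mf fM (l + n) (T y).
have bc := chain_op_bounded mf fM (l + n) (T y).
have ic := bounded_integrable (Q1 (y 0, x)) mc bc.
have icst r : (Q (y 0, x)).-integrable setT (EFin \o cst r).
  exact: (bounded_integrable (Q1 (y 0, x)) (M := `|r|)).
have icc : (Q (y 0, x)).-integrable setT
    (EFin \o (fun z => chain_op (l + n) f (T y) z - c)).
  exact: (integrableB measurableT ic (icst c)).
have iC1 : (Q (y 0, x)).-integrable setT (EFin \o (fun z => C1 * V z)).
  rewrite [X in _.-integrable _ X](_ : _ = fun z => (C1%:E * (EFin \o V) z)%E)//.
  exact: integrableZl.
rewrite -[X in `|_ - X|](Rintegral_cst1 c (Q1 (y 0, x))) -RintegralB//;
  last exact: (icst c).
apply: le_trans (le_normr_Rintegral _ _) _ => //.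
apply: (@le_trans _ _ (\int[Q (y 0, x)]_z (C0 + C1 * V z))).
  apply: le_Rintegral => //.
  - exact: (integrable_norm icc).
  - exact: (integrableD measurableT (icst C0) iC1).
  move=> z _; apply: le_trans (IH (T y) z) _.
  by rewrite /C0 /C1 -/P -/wx le_eqVlt; apply/orP; left; apply/eqP; ring.
rewrite RintegralD//; last exact: (icst C0).
rewrite Rintegral_cst1// RintegralZl//.
rewrite /C0 /C1 -mulrA -mulrDr ler_wpM2l//.
have s_ge0 : 0 <= sigma ^+ l by rewrite exprn_ge0// ltW.
have h1 : w (T y) * \int[Q (y 0, x)]_z V z <= sigma * w y * V x + 4^-1.
  by apply: le_trans (w_drift y (V_ge0 x)); rewrite ler_wpM2l.
have := ler_wpM2l s_ge0 h1.
have BE : B0 * (1 - sigma) = 4^-1 by rewrite /B0; field; lra.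
rewrite -BE exprSr mulrA.
move: (sigma ^+ l) (\int[_]_z V z) => s I.
rewrite (_ : s * (sigma * w y * V x + B0 * (1 - sigma)) =
  s * sigma * w y * V x + s * B0 * (1 - sigma)); last by ring.
by lra.
Qed.

Lemma chain_op_shift l n f M y x x0 : measurable_fun setT f ->
  (forall x, `|f x| <= M) ->
  `|chain_op (l + n) f y x - chain_op n f (iter l T y) x0| <=
    2 * M * prodr n (iter l T y) * (1 + V x0 + tightness_cst + V x).
Proof.
move=> mf fM; have /andP[s0 s1] := sigma01.
have M0 : 0 <= M by exact: le_trans (fM point).
apply: le_trans (chain_op_shift_aux _ _ _ _ _ mf fM) _.
apply: ler_wpM2l.
  by rewrite !mulr_ge0//; have /andP[] := orbit_prod01 T rho01 n (iter l T y).
have sl : sigma ^+ l <= 1 by apply: exprn_ile1; exact: ltW.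
have sl0 : 0 <= sigma ^+ l by rewrite exprn_ge0// ltW.
rewrite !lerD//.
- by rewrite ler_piMl.
- by rewrite /tightness_cst -[leRHS]mulr1 ler_wpM2l ?tightness_cst_ge0//; lra.
- by rewrite ler_piMl// mulr_ile1.
Qed.

Section stationary_environment.
Variable PY : probability pathT R.
Hypothesis PYshift : forall A, measurable A -> PY (T @^-1` A) = PY A.
Hypothesis mrho : measurable_fun setT rho.

Let p1 : PY setT = 1%E. Proof. exact: probability_setT. Qed.

Definition mean_rate n : R := \int[PY]_y prodr n y.

Definition annealed_law n f x : R := \int[PY]_y chain_op n f y x.

Let mT := measurable_shift_by Ysp 1.

Let mprod n := measurable_orbit_prod mT mrho n.

Let prod1 n y : `|prodr n y| <= 1.
Proof. by have /andP[? ?] := orbit_prod01 T rho01 n y; rewrite ger0_norm. Qed.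

(** After l steps the chain is compared with one restarted at x0; by stationarity the latter has the
    annealed law at time n. Equal starting points give the Cauchy property, and l = 0 gives
    independence of the starting point. *)
Lemma annealed_law_cauchy l n f M x x0 : measurable_fun setT f ->
  (forall x, `|f x| <= M) ->
  `|annealed_law (l + n) f x - annealed_law n f x0| <=
    2 * M * (1 + V x0 + tightness_cst + V x) * mean_rate n.
Proof.
move=> mf fM.
have m1 := measurable_chain_op1 mf fM (l + n) x.
have b1 y := chain_op_bounded mf fM (l + n) y x.
have m2 := measurable_chain_op1 mf fM n x0.
have b2 y := chain_op_bounded mf fM n y x0.
have mTl := measurable_iter mT l.
have m2T : measurable_fun setT (fun y => chain_op n f (iter l T y) x0).
  exact: (measurableT_comp m2 mTl).
have i1 := bounded_integrable p1 m1 b1.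
have i2 := bounded_integrable p1 m2T (fun y => b2 (iter l T y)).
have i12 := integrableB measurableT i1 i2.
rewrite /annealed_law -(Rintegral_preserving_iter mT PYshift l m2 b2) -RintegralB//.
apply: le_trans (le_normr_Rintegral _ _) _ => //.
set C := 2 * M * _.
rewrite /mean_rate -(Rintegral_preserving_iter mT PYshift l (mprod n) (prod1 n)).
have mpT : measurable_fun setT (fun y => prodr n (iter l T y)).
  exact: measurableT_comp (mprod n) mTl.
have ip := bounded_integrable p1 mpT (fun y => prod1 n (iter l T y)).
rewrite -RintegralZl//; apply: le_Rintegral => //.
- exact: (integrable_norm i12).
- rewrite [X in _.-integrable _ X](_ : _ =
    fun y => (C%:E * (EFin \o (fun y => prodr n (iter l T y))) y)%E)//.
  exact: integrableZl.
move=> y _; apply: le_trans (chain_op_shift _ _ _ _ _ mf fM) _.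
by rewrite /C mulrAC.
Qed.

End stationary_environment.

End contraction.

End chain_operator.

(** * Limits of set functions that are Cauchy uniformly over measurable sets *)

Section setwise_limit.
Context (R : realType) d (X : measurableType d).
Variables (p : nat -> set X -> R) (del : nat -> R).
Hypothesis p_ge0 : forall n B, 0 <= p n B.
Hypothesis p0 : forall n, p n set0 = 0.
Hypothesis pT : forall n, p n setT = 1.
Hypothesis pU : forall n A B, measurable A -> measurable B -> A `&` B = set0 ->
  p n (A `|` B) = p n A + p n B.
Hypothesis p_bigcup : forall n F, (forall i, measurable (F i)) -> trivIset setT F ->
  p n (\big[setU/set0]_(0 <= i < k) F i) @[k --> \oo] --> p n (\bigcup_i F i).
Hypothesis p_cauchy : forall B m n, measurable B -> (n <= m)%N ->
  `|p m B - p n B| <= del n.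
Hypothesis del0 : del n @[n --> \oo] --> (0 : R).

Let del_ge0 n : 0 <= del n.
Proof. by apply: le_trans (p_cauchy measurable0 (leqnn n)). Qed.

(** Each p n B + del n bounds the limit from above and the bounds are asymptotically sharp. The
    infimum makes sense for every set B, and the distance to p n B on measurable sets can be read
    off from it. *)
Let lval B : R := inf (range (fun n => p n B + del n)).

Let has_lb B : has_lbound (range (fun n => p n B + del n)).
Proof. by exists 0 => _ [n _ <-]; rewrite addr_ge0. Qed.

Let lval_close B n : measurable B -> `|lval B - p n B| <= del n.
Proof.
move=> mB; rewrite ler_distl; apply/andP; split; last first.
  by apply: ge_inf => //; exists n.
apply: lb_le_inf; first by exists (p 0%N B + del 0%N); exists 0%N.
move=> _ [m _ <-]; have [mn|nm] := leqP m n.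
  have := p_cauchy mB mn; rewrite ler_distl => /andP[_].
  by have := del_ge0 n; lra.
have := p_cauchy mB (ltnW nm); rewrite ler_distl => /andP[+ _].
by have := del_ge0 m; lra.
Qed.

Let lval_eq (a : R) (C : R) : (forall n, `|a| <= C * del n) -> a = 0.
Proof.
move=> h; apply/eqP; rewrite -normr_le0.
have c : C * del n @[n --> \oo] --> C * 0 by apply: cvgM => //; exact: cvg_cst.
by rewrite mulr0 in c; apply: cvgr_to_ge c _; exact: nearW.
Qed.

Let lvalU A B : measurable A -> measurable B -> A `&` B = set0 ->
  lval (A `|` B) = lval A + lval B.
Proof.
move=> mA mB AB; apply/eqP; rewrite -subr_eq0; apply/eqP.
apply: (lval_eq (C := 3)) => n.
have h1 := lval_close n (measurableU _ _ mA mB).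
have h2 := lval_close n mA; have h3 := lval_close n mB.
rewrite pU// in h1; move: h1 h2 h3; rewrite !ler_norml => /andP[? ?] /andP[? ?] /andP[? ?].
by apply/andP; split; lra.
Qed.

Definition limit_measure B : \bar R := (lval B)%:E.

Let limit0 : limit_measure set0 = 0%E.
Proof.
congr EFin; apply: (lval_eq (C := 1)) => n.
by rewrite mul1r; have := lval_close n measurable0; rewrite p0 subr0.
Qed.

Let limit_ge0 B : (0 <= limit_measure B)%E.
Proof.
rewrite lee_fin; apply: lb_le_inf; first by exists (p 0%N B + del 0%N); exists 0%N.
by move=> _ [n _ <-]; rewrite addr_ge0.
Qed.

(** Because del does not depend on the set, one index N serves the union and all its finite parts at
    once, and sigma-additivity is inherited from p N. *)
Let limit_sigma_additive : semi_sigma_additive limit_measure.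
Proof.
move=> F mF tF mUF.
pose U k := \big[setU/set0]_(0 <= i < k) F i.
have mU k : measurable (U k) by exact: bigsetU_measurable.
have sumE k : (\sum_(0 <= i < k) limit_measure (F i) = (lval (U k))%:E)%E.
  elim: k => [|k IH]; first by rewrite /U !big_nil -limit0.
  rewrite big_nat_recr//= IH /U big_nat_recr//= lvalU//; first exact: mU.
  rewrite big_mkord (@trivIset_bigsetUI _ xpredT)//.
  by rewrite [X in trivIset X F](_ : _ = setT)//; exact/seteqP.
rewrite (_ : (fun n => _) = EFin \o (fun k => lval (U k))); last first.
  by apply/funext => k; rewrite sumE.
apply: cvg_EFin; first exact: nearW.
apply/cvgrPdist_le => e e0.
have e3 : 0 < e / 3 by lra.
have /cvgrPdist_le /(_ _ e3) [N _ /(_ N (leqnn N))] := del0.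
rewrite sub0r normrN ger0_norm// => dN.
have /cvgrPdist_le /(_ _ e3) := @p_bigcup N F mF tF.
apply: filterS => k /=; rewrite -/(U k) => h1.
have h2 := lval_close N (mU k); have h3 := lval_close N mUF.
move: h1 h2 h3; rewrite !ler_norml => /andP[? ?] /andP[? ?] /andP[? ?].
by apply/andP; split; lra.
Qed.

HB.instance Definition _ := isMeasure.Build _ _ _ limit_measure
  limit0 limit_ge0 limit_sigma_additive.

Let limitT : limit_measure setT = 1%E.
Proof.
congr EFin; apply/eqP; rewrite -subr_eq0; apply/eqP; apply: (lval_eq (C := 1)) => n.
by rewrite mul1r; have := lval_close n measurableT; rewrite pT.
Qed.

HB.instance Definition _ := Measure_isProbability.Build _ _ _ limit_measure limitT.

Lemma setwise_limit : exists mu : probability X R,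
  forall B n, measurable B -> `|fine (mu B) - p n B| <= del n.
Proof. by exists limit_measure => B n mB; exact: lval_close. Qed.

End setwise_limit.

Definition image_measure (R : realType) d1 d2 (T1 : measurableType d1)
    (T2 : measurableType d2) (m : {measure set T1 -> \bar R}) (f : T1 -> T2)
    (mf : measurable_fun setT f) : {measure set T2 -> \bar R} :=
  measure_function_pushforward__canonical__measure_function_Measure m mf.

(** * The chain in its random environment *)

Section conditional_kernel.
Context (R : realType) dO dF dX (Omega : measurableType dO) (F : measurableType dF)
  (Xsp : measurableType dX) (P : probability Omega R).
Variables (iota : Omega -> F) (Xi : Omega -> Xsp) (q : R.-pker Omega ~> Xsp).
Hypothesis miota : measurable_fun setT iota.
Hypothesis mXi : measurable_fun setT Xi.
Hypothesis q_cond : forall A B, measurable A -> measurable B ->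
  (\int[P]_(w in iota @^-1` A) q w B = P (Xi @^-1` B `&` iota @^-1` A))%E.

Let mpair w : measurable_fun setT (fun z : Xsp => (iota w, z)).
Proof. by apply: measurable_fun_pair. Qed.

Let mjoint : measurable_fun setT (fun w => (iota w, Xi w)).
Proof. exact: measurable_fun_pair. Qed.

(** The law of (iota w, z) for z drawn from q w. The unit component is the format of [kcomp], whose
    first kernel is the constant P. *)
Definition kgraph (_ : measurable_fun setT iota) (p : unit * Omega) :
  {measure set (F * Xsp) -> \bar R} := image_measure (q p.2) (mpair p.2).

Let measurable_kgraph U : measurable U -> measurable_fun setT ((kgraph miota) ^~ U).
Proof.
move=> mU; pose U' := [set p : Omega * Xsp | U (iota p.1, p.2)].
have mU' : measurable U'.
  rewrite -[U']setTI; have : measurable_fun setT (fun p : Omega * Xsp => (iota p.1, p.2)).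
    apply: measurable_fun_pair; last exact: measurable_snd.
    exact: measurableT_comp miota measurable_fst.
  exact.
have mphi := measurable_fun_xsection_finite_kernel q (mem_set mU').
rewrite [X in measurable_fun _ X](_ : _ = (fun w => q w (xsection U' w)) \o snd).
  exact: measurableT_comp mphi measurable_snd.
by apply/funext => p /=; rewrite xsectionE.
Qed.

HB.instance Definition _ := isKernel.Build _ _ _ _ _ (kgraph miota) measurable_kgraph.

Let kgraph_prob a : kgraph miota a setT = 1%E.
Proof. exact: prob_kernel. Qed.

HB.instance Definition _ :=
  Kernel_isProbability.Build _ _ _ _ _ (kgraph miota) kgraph_prob.

Definition kcst (_ : unit) : {measure set Omega -> \bar R} := P.

Let measurable_kcst U : measurable U -> measurable_fun setT (kcst ^~ U).
Proof. by move=> mU; exact: measurable_cst. Qed.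

HB.instance Definition _ := isKernel.Build _ _ _ _ _ kcst measurable_kcst.

Let kcst_prob a : kcst a setT = 1%E.
Proof. exact: probability_setT. Qed.

HB.instance Definition _ := Kernel_isProbability.Build _ _ _ _ _ kcst kcst_prob.

(** [q_cond] is the case of indicators of rectangles. These form a generating pi-system, so the
    joint law of iota and Xi equals the composition of P with [kgraph]. *)
Lemma integral_cond_kernel (G : F * Xsp -> \bar R) : measurable_fun setT G ->
  (forall p, (0 <= G p)%E) ->
  (\int[P]_w G (iota w, Xi w) = \int[P]_w \int[q w]_z G (iota w, z))%E.
Proof.
move=> mG G0.
pose m1 := image_measure P mjoint.
have -> : (\int[P]_w G (iota w, Xi w) = \int[m1]_p G p)%E.
  by rewrite (ge0_integral_pushforward mjoint).
transitivity (\int[kcomp kcst (kgraph miota) tt]_p G p)%E; last first.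
  rewrite integral_kcomp//; apply: eq_integral => w _.
  by rewrite /kgraph (ge0_integral_pushforward (mpair w)).
apply: eq_measure_integral => A mA _.
apply: (@measure_unique _ _ _
  [set A `*` B | A in @measurable _ F & B in @measurable _ Xsp] (fun=> setT)) => //.
- exact: measurable_prod_measurableType.
- move=> X1 Y1 [A1 mA1 [B1 mB1 <-]] [A2 mA2 [B2 mB2 <-]].
  exists (A1 `&` A2); first exact: measurableI.
  by exists (B1 `&` B2); [exact: measurableI|rewrite setXI].
- by move=> i; exists setT => //; exists setT => //; rewrite setXTT.
- by rewrite bigcup_const//; exists 0%N.
- move=> _ [A1 mA1 [B1 mB1 <-]].
  rewrite /m1 /kcomp /kgraph /kcst /pushforward/=.
  transitivity (\int[P]_(w in iota @^-1` A1) q w B1)%E.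
    by rewrite q_cond//; congr (P _); apply/seteqP; split => w /= [].
  rewrite integral_mkcond; apply: eq_integral => w _; rewrite patchE.
  have [|] := boolP (w \in iota @^-1` A1); rewrite ?inE ?notin_setE/= => h.
    by congr (q w _); apply/seteqP; split => z //= [].
  by rewrite [X in _ = q w X](_ : _ = set0) ?measure0//; apply/seteqP; split => z //= [].
- by move=> k /=; rewrite [X in (X < _)%E](_ : _ = P setT)// probability_setT ltry.
Qed.

Lemma Rintegral_cond_kernel (G : F * Xsp -> R) (M : R) : measurable_fun setT G ->
  (forall p, `|G p| <= M) ->
  \int[P]_w G (iota w, Xi w) = \int[P]_w \int[q w]_z G (iota w, z).
Proof.
move=> mG GM.
have p1 : P setT = 1%E by exact: probability_setT.
have q1 w : q w setT = 1%E by exact: prob_kernel.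
have m1 : measurable_fun setT (fun w => G (iota w, Xi w)).
  exact: (measurableT_comp mG mjoint).
have mGw w : measurable_fun setT (fun z => G (iota w, z)).
  exact: (measurableT_comp mG (mpair w)).
have m2 : measurable_fun setT (fun w => \int[q w]_z G (iota w, z)).
  apply: (@measurable_Rintegral_kernel R _ _ _ Omega Omega Xsp q id
    (@measurable_id _ _ setT) (fun p => G (iota p.1, p.2)) M) => //.
  apply: (measurableT_comp mG); apply: measurable_fun_pair; last exact: measurable_snd.
  exact: measurableT_comp miota measurable_fst.
have b2 w : `|\int[q w]_z G (iota w, z)| <= M.
  by apply: (Rintegral_bounded (q1 w)).
have addM d (T : measurableType d)
    (m' : {measure set T -> \bar R}) (f : T -> R) : m' setT = 1%E -> measurable_fun setT f ->
    (forall x, `|f x| <= M) -> (\int[m']_x (f x + M)%:E)%E = (\int[m']_x f x + M)%:E.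
  move=> h mf fM.
  rewrite -[X in _ = (_ + X)%:E](Rintegral_cst1 M h) -RintegralD//; last 2 first.
  - exact: bounded_integrable h mf fM.
  - exact: (bounded_integrable h (M := `|M|)).
  apply: (bounded_fin_num_integral (M := M + `|M|)) => //.
    exact: measurable_funD.
  by move=> x; rewrite (le_trans (ler_normD _ _))// lerD2r.
have := @integral_cond_kernel (fun p => (G p + M)%:E).
have mGM : measurable_fun setT (fun p => (G p + M)%:E).
  by apply/measurable_EFinP; exact: measurable_funD.
move=> /(_ mGM) => h.
have {}h := h (fun p => ltac:(rewrite lee_fin; have := GM p; rewrite ler_norml => /andP[]; lra)).
move: h; rewrite (addM _ _ P (fun w => G (iota w, Xi w)))//.
under eq_integral => w _ do
  rewrite (addM _ _ (q w) (fun z => G (iota w, z)) (q1 w) (mGw w) (fun z => GM _)).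
rewrite addM//; by move=> [] /addIr.
Qed.

End conditional_kernel.

Section filtration.
Context (R : realType) dO dX dY (Omega : measurableType dO) (Xsp : measurableType dX)
  (Ysp : measurableType dY) (P : probability Omega R).
Variables (Y : int -> {RV P >-> Ysp}) (X : nat -> {RV P >-> Xsp}).

Local Notation T := (@shift_by _ Ysp 1).

Lemma measurable_env_path :
  measurable_fun setT (env_path Y : Omega -> pathT Ysp).
Proof. by apply: measurable_to_path => t; exact: measurable_funPT. Qed.

Definition env_law : probability (pathT Ysp) R :=
  distribution P (mfun_Sub (mem_set measurable_env_path)).

Lemma Rintegral_env_law (F : pathT Ysp -> R) (M : R) : measurable_fun setT F ->
  (forall y, `|F y| <= M) -> \int[env_law]_y F y = \int[P]_w F (env_path Y w).
Proof.
move=> mF FM; rewrite /Rintegral (integral_pushforward measurable_env_path)//.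
  exact/measurable_EFinP.
rewrite preimage_setT; apply: (bounded_integrable (probability_setT P) (M := M)) => //.
exact: measurableT_comp mF measurable_env_path.
Qed.

(** The generator of [chain_filtration], turned into the type [past t]: adaptedness to time t
    becomes measurability of functions defined on [past t]. *)
Definition filtration_gen t : set_system Omega :=
  (\bigcup_(s in [set s : nat | (s <= t)%N])
     preimage_set_system setT (X s) measurable) `|`
  (\bigcup_(s in [set: int]) preimage_set_system setT (Y s) measurable).

Definition past t := g_sigma_algebraType (filtration_gen t).

Lemma measurable_to_past t d (S : measurableType d) (f : S -> past t) :
  (forall s, (s <= t)%N -> measurable_fun setT (fun w => X s (f w))) ->
  (forall s, measurable_fun setT (fun w => Y s (f w))) -> measurable_fun setT f.
Proof.
move=> mX mY; apply: (@measurability _ _ S (past t) setT f (filtration_gen t)) => //.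
move=> _ [_ [[s st [B mB <-]]|[s _ [B mB <-]]] <-].
  rewrite [X in measurable X](_ : _ = setT `&` (fun w => X s (f w)) @^-1` B); last first.
    by apply/seteqP; split => w //= [_ []].
  exact: mX.
rewrite [X in measurable X](_ : _ = setT `&` (fun w => Y s (f w)) @^-1` B); last first.
  by apply/seteqP; split => w //= [_ []].
exact: mY.
Qed.

Lemma measurable_past_X t s : (s <= t)%N ->
  measurable_fun setT (fun w : past t => X s w).
Proof.
move=> st _ B mB; apply: sub_sigma_algebra; left; exists s => //; exists B => //.
Qed.

Lemma measurable_past_Y t s : measurable_fun setT (fun w : past t => Y s w).
Proof.
move=> _ B mB; apply: sub_sigma_algebra; right; exists s => //; exists B => //.
Qed.

Lemma measurable_past_env t :
  measurable_fun setT (fun w : past t => env_path Y w : pathT Ysp).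
Proof. by apply: measurable_to_path => s; exact: measurable_past_Y. Qed.

Lemma measurable_past_id t : measurable_fun setT (fun w : Omega => w : past t).
Proof. by apply: measurable_to_past => s *; exact: measurable_funPT. Qed.

Lemma measurable_past_le s t : (s <= t)%N ->
  measurable_fun setT (fun w : past t => w : past s).
Proof.
move=> st; apply: measurable_to_past => r *; last exact: measurable_past_Y.
by apply: measurable_past_X; exact: leq_trans st.
Qed.

End filtration.
Arguments measurable_env_path {R dO dY Omega Ysp P} Y.
Arguments measurable_past_env {R dO dX dY Omega Xsp Ysp P} Y X t.
Arguments measurable_past_id {R dO dX dY Omega Xsp Ysp P} Y X t.
Arguments measurable_past_le {R dO dX dY Omega Xsp Ysp P} Y X {s t}.

(** * Markov property, decorrelation and averages along the chain *)

Section chain_in_random_environment.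
Context (R : realType) dO dX dY (Omega : measurableType dO) (Xsp : measurableType dX)
  (Ysp : measurableType dY) (P : probability Omega R).
Variables (Y : int -> {RV P >-> Ysp}) (X : nat -> {RV P >-> Xsp}).
Variables (Q : R.-pker (Ysp * Xsp)%type ~> Xsp) (x0 : Xsp).
Hypothesis chain : chain_in_environment Y Q x0 X.
Implicit Types (f : Xsp -> R) (M N : R).

Local Notation pathT := (pathT Ysp).
Local Notation T := (@shift_by _ Ysp 1).
Local Notation past := (past Y X).
Local Notation env w := (env_path Y w : pathT).

Let P1 : P setT = 1%E. Proof. exact: probability_setT. Qed.

Let mstate t : measurable_fun setT (fun w => (Y t%:Z w, X t w)).
Proof. by apply: measurable_fun_pair. Qed.

Let cond_past t A B : @measurable _ (past t) A -> measurable B ->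
  (\int[P]_(w in (fun w : Omega => w : past t) @^-1` A) kpre Q (mstate t) w B =
   P (X t.+1 @^-1` B `&` (fun w : Omega => w : past t) @^-1` A))%E.
Proof. by move=> mA mB; exact: (chain.2 t B mB).2 A mA. Qed.

Lemma Rintegral_one_step t (G : past t * Xsp -> R) M : measurable_fun setT G ->
  (forall p, `|G p| <= M) ->
  \int[P]_w G (w, X t.+1 w) = \int[P]_w \int[Q (Y t%:Z w, X t w)]_z G (w, z).
Proof.
exact: (Rintegral_cond_kernel (measurable_past_id Y X t) _ (@cond_past t)).
Qed.

Lemma ge0_integral_one_step t (G : past t * Xsp -> \bar R) : measurable_fun setT G ->
  (forall p, (0 <= G p)%E) ->
  (\int[P]_w G (w, X t.+1 w) = \int[P]_w \int[Q (Y t%:Z w, X t w)]_z G (w, z))%E.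
Proof.
exact: (integral_cond_kernel (measurable_past_id Y X t) _ (@cond_past t)).
Qed.

Lemma iter_shift_env t w : iter t T (env w) 0 = Y t%:Z w.
Proof. by rewrite iter_shift /shift_by add0r. Qed.

Lemma measurable_past_iter s t :
  measurable_fun setT (fun w : past t => iter s T (env w)).
Proof.
exact: measurableT_comp (measurable_iter (measurable_shift_by Ysp 1) s)
  (measurable_past_env Y X t).
Qed.

Lemma measurable_env_iter s : measurable_fun setT (fun w : Omega => iter s T (env w)).
Proof.
exact: measurableT_comp (measurable_iter (measurable_shift_by Ysp 1) s)
  (measurable_env_path Y).
Qed.

Lemma measurable_past_chain_op n f M s t : measurable_fun setT f ->
  (forall x, `|f x| <= M) ->
  measurable_fun setT (fun p : past t * Xsp => chain_op Q n f (iter s T (env p.1)) p.2).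
Proof.
move=> mf fM; have mc := measurable_chain_op Q mf fM n.
have mp : measurable_fun setT (fun p : past t * Xsp => (iter s T (env p.1), p.2)).
  apply: measurable_fun_pair; last exact: measurable_snd.
  exact: measurableT_comp (@measurable_past_iter s t) measurable_fst.
exact: (measurableT_comp mc mp).
Qed.

(** The Markov property over n steps, tested against bounded functions of the past. The past
    contains the whole environment, future included, so the shifted environment is a parameter when
    the next state is integrated out. *)
Lemma Rintegral_chain_op n f M t (D : past t -> R) N : measurable_fun setT f ->
  (forall x, `|f x| <= M) -> measurable_fun setT D -> (forall w, `|D w| <= N) ->
  \int[P]_w (D w * f (X (t + n)%N w)) =
  \int[P]_w (D w * chain_op Q n f (iter t T (env w)) (X t w)).
Proof.
move=> mf fM; elim: n t D => [|n IH] t D mD DN; first by rewrite addn0.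
rewrite addnS -addSn (IH t.+1 D)//; last first.
  exact: (measurableT_comp mD (measurable_past_le Y X (leqnSn t))).
have mG : measurable_fun setT
    (fun p : past t * Xsp => D p.1 * chain_op Q n f (iter t.+1 T (env p.1)) p.2).
  apply: measurable_funM; last exact: measurable_past_chain_op mf fM.
  exact: measurableT_comp mD measurable_fst.
rewrite (Rintegral_one_step (M := N * M) mG); last first.
  by move=> p; rewrite normrM ler_pM// (chain_op_bounded Q mf fM).
apply: eq_Rintegral => w _ /=; rewrite iter_shift_env RintegralZl//.
exact: integrable_chain_op mf fM _ _ _.
Qed.

Section stationary.
Variables (V : Xsp -> R) (gamma K alpha radius : Ysp -> R).
Variables (kappa : R.-pker Ysp ~> Xsp) (w rho : pathT -> R) (sigma : R).
Hypothesis mV : measurable_fun setT V.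
Hypothesis V_ge0 : forall x, 0 <= V x.
Hypothesis iV : forall p, (Q p).-integrable setT (EFin \o V).
Hypothesis QV : forall y x, \int[Q (y, x)]_z V z <= gamma y * V x + K y.
Hypothesis alpha01 : forall y, 0 <= alpha y < 1.
Hypothesis minor : forall y x A, measurable A -> V x <= radius y ->
  (1 - alpha y) * fine (kappa y A) <= fine (Q (y, x) A).
Hypothesis w_ge0 : forall y, 0 <= w y.
Hypothesis w_le1 : forall y, w y <= 1.
Hypothesis mw : measurable_fun setT w.
Hypothesis rho01 : forall y, 0 <= rho y <= 1.
Hypothesis mrho : measurable_fun setT rho.
Hypothesis sigma01 : 0 < sigma < 1.
Hypothesis w_drift : forall y v, 0 <= v ->
  w (T y) * (gamma (y 0) * v + K (y 0)) <= sigma * w y * v + 4^-1.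
Hypothesis inside : forall y W, 0 <= W ->
  alpha (y 0) + w (T y) * (gamma (y 0) * W + 2 * K (y 0)) <= rho y * (1 + w y * W).
Hypothesis outside : forall y W, radius (y 0) < W ->
  1 + w (T y) * (gamma (y 0) * W + 2 * K (y 0)) <= rho y * (1 + w y * W).
Hypothesis PYshift : forall A, measurable A -> env_law Y (T @^-1` A) = env_law Y A.

Local Notation prodr := (orbit_prod T rho).
Local Notation B := (tightness_cst sigma).
Local Notation r n := (mean_rate rho (env_law Y) n).

Let measurable_wV t : measurable_fun setT (fun v => w (iter t T (env v)) * V (X t v)).
Proof.
apply: measurable_funM; first exact: measurableT_comp mw (@measurable_env_iter t).
exact: measurableT_comp.
Qed.

(** The arbitrary factor h makes this a bound conditional on the environment. V x0 + B survives the
    induction since 4^-1 = B (1 - sigma). Extended reals are used because integrability of V along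
    the chain is part of the conclusion. *)
Lemma expectation_weight (h : pathT -> R) t : measurable_fun setT h ->
  (forall y, 0 <= h y <= 1) ->
  (\int[P]_v (h (env v) * (w (iter t T (env v)) * V (X t v)))%:E <=
   ((V x0 + B) * \int[P]_v h (env v))%:E)%E.
Proof.
move=> mh h01; have /andP[s0 s1] := sigma01.
have B0 : 0 <= B := tightness_cst_ge0 sigma01.
have h0 y : 0 <= h y by have /andP[] := h01 y.
have hN y : `|h y| <= 1 by have /andP[? ?] := h01 y; rewrite ger0_norm.
have mhe : measurable_fun setT (fun v => h (env v)).
  exact: measurableT_comp mh (measurable_env_path Y).
have hE := bounded_fin_num_integral P1 mhe (fun v => hN (env v)).
elim: t => [|t IH].
  rewrite EFinM -hE -ge0_integralZl//=; last 3 first.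
  - exact/measurable_EFinP.
  - by move=> v _; rewrite lee_fin.
  - by rewrite lee_fin addr_ge0.
  apply: ge0_le_integral => //=.
  - by move=> v _; rewrite lee_fin !mulr_ge0.
  - by apply/measurable_EFinP; apply: measurable_funM => //; exact: (measurable_wV 0).
  - by apply/measurable_EFinP; exact: measurable_funM.
  move=> v _; rewrite -EFinM lee_fin chain.1 mulrC ler_wpM2r//.
  by rewrite (@le_trans _ _ (V x0))// ?lerDl// ler_piMl.
pose G (p : past t * Xsp) := h (env p.1) * (w (iter t.+1 T (env p.1)) * V p.2).
have mG : measurable_fun setT G.
  apply: measurable_funM.
    apply: measurableT_comp mh _.
    exact: measurableT_comp (measurable_past_env Y X t) measurable_fst.
  apply: measurable_funM; last exact: measurableT_comp mV measurable_snd.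
  apply: measurableT_comp mw _.
  exact: measurableT_comp (@measurable_past_iter t.+1 t) measurable_fst.
have G0 p : 0 <= G p by rewrite !mulr_ge0.
have := @ge0_integral_one_step t (fun p => (G p)%:E).
have mGE : measurable_fun setT (fun p => (G p)%:E) by exact/measurable_EFinP.
move=> /(_ mGE) => h1; rewrite (h1 (fun p => G0 p)) {h1}.
have inner v : (\int[Q (Y t%:Z v, X t v)]_z (G (v, z))%:E <=
    (sigma * (h (env v) * (w (iter t T (env v)) * V (X t v))) + 4^-1 * h (env v))%:E)%E.
  set c := h (env v) * w (iter t.+1 T (env v)).
  have c0 : 0 <= c by rewrite mulr_ge0.
  have -> : (\int[Q (Y t%:Z v, X t v)]_z (G (v, z))%:E =
      (c * \int[Q (Y t%:Z v, X t v)]_z V z)%:E)%E.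
    rewrite EFinM /Rintegral fineK; last exact: integrable_fin_num.
    rewrite -integralZl//; apply: eq_integral => z _.
    by rewrite -EFinM /G /c /= mulrA.
  rewrite lee_fin; apply: (@le_trans _ _ (c * (gamma (Y t%:Z v) * V (X t v) + K (Y t%:Z v)))).
    by rewrite ler_wpM2l.
  have := w_drift (iter t T (env v)) (V_ge0 (X t v)).
  rewrite iter_shift_env => /(ler_wpM2l (h0 (env v))) hle.
  rewrite /c -mulrA; apply: (le_trans hle).
  by rewrite le_eqVlt; apply/orP; left; apply/eqP; ring.
pose a v := h (env v) * (w (iter t T (env v)) * V (X t v)).
have ma : measurable_fun setT a by exact: measurable_funM.
have a0 v : 0 <= a v by rewrite !mulr_ge0.
apply: (@le_trans _ _ (\int[P]_v (sigma%:E * (a v)%:E + 4^-1%:E * (h (env v))%:E))%E).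
  apply: ge0_le_integral => //.
  - by move=> v _; apply: integral_ge0 => z _; rewrite lee_fin.
  - rewrite (_ : (fun v => _) = fun v =>
      (h (env v) * w (iter t.+1 T (env v)))%:E * (\int[Q (Y t%:Z v, X t v)]_z (V z)%:E))%E.
      apply: emeasurable_funM.
        apply/measurable_EFinP; apply: measurable_funM => //.
        exact: measurableT_comp mw (@measurable_env_iter t.+1).
      apply: (measurable_fun_integral_finite_kernel (fun p : Omega * Xsp => (V p.2)%:E)
        (kpre Q (mstate t))) => [p|]; first by rewrite lee_fin.
      by apply/measurable_EFinP; exact: measurableT_comp mV measurable_snd.
    apply/funext => v; rewrite -ge0_integralZl//; last 3 first.
    + exact/measurable_EFinP.
    + by move=> z _; rewrite lee_fin.
    + by rewrite lee_fin mulr_ge0.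
    by apply: eq_integral => z _; rewrite -EFinM /G /= mulrA.
  - by apply: emeasurable_funD; apply/measurable_EFinP; exact: measurable_funM.
rewrite ge0_integralD//; last 4 first.
- by move=> v _; rewrite -EFinM lee_fin mulr_ge0// ltW.
- by apply/measurable_EFinP; exact: measurable_funM.
- by move=> v _; rewrite -EFinM lee_fin mulr_ge0.
- by apply/measurable_EFinP; exact: measurable_funM.
rewrite ge0_integralZl//; last 3 first.
- exact/measurable_EFinP.
- by move=> v _; rewrite lee_fin.
- by rewrite lee_fin ltW.
rewrite ge0_integralZl//; last 2 first.
- exact/measurable_EFinP.
- by move=> v _; rewrite lee_fin.
rewrite hE; apply: (@le_trans _ _
  (sigma%:E * ((V x0 + B) * \int[P]_v h (env v))%:E + 4^-1%:E * (\int[P]_v h (env v))%:E)%E).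
  by rewrite leeD2r// lee_wpmul2l// lee_fin ltW.
rewrite -!EFinM -EFinD lee_fin.
have I0 : 0 <= \int[P]_v h (env v) by exact: Rintegral_ge0.
have BE : B * (1 - sigma) = 4^-1 by rewrite /tightness_cst; field; lra.
rewrite -BE; move: I0 (V_ge0 x0) B0; move: (\int[P]_v _) (V x0) B => I v b I0 v0 b0.
have : 0 <= (1 - sigma) * v * I by rewrite !mulr_ge0// subr_ge0 ltW.
by lra.
Qed.

Let dec_cst : R := 1 + 2 * V x0 + B.

Let dec_cst_ge0 : 0 <= dec_cst.
Proof. by rewrite /dec_cst !addr_ge0 ?mulr_ge0// tightness_cst_ge0. Qed.

Let mT := measurable_shift_by Ysp 1.

Let measurable_state n : measurable_fun setT (X n).
Proof. exact: measurable_funPT. Qed.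

Section observable.
Variables (f : Xsp -> R) (M : R).
Hypothesis mf : measurable_fun setT f.
Hypothesis fM : forall x, `|f x| <= M.

Let M0 : 0 <= M. Proof. exact: le_trans (fM point). Qed.

(** Given the past, f (X (t + n)) has mean [chain_op] at X t, and contraction moves the start to x0.
    The error involves V (X t), which [expectation_weight] controls with h the product of the rates
    after time t. In [dec_cst], 1 + V x0 comes from the constant and the restart, V x0 + B from the
    running chain. *)
Lemma decorrelation n t (D : past t -> R) N :
  measurable_fun setT D -> (forall v, `|D v| <= N) ->
  `|\int[P]_v (D v * (f (X (t + n)%N v) - chain_op Q n f (iter t T (env v)) x0))| <=
    2 * M * N * dec_cst * r n.
Proof.
move=> mD DN; have N0 : 0 <= N by exact: le_trans (DN point).
have mDO : measurable_fun setT (D : Omega -> R).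
  exact: (measurableT_comp mD (measurable_past_id Y X t)).
have mfX : measurable_fun setT (fun v => f (X (t + n)%N v)) by exact: measurableT_comp.
have mcx : measurable_fun setT (fun v => chain_op Q n f (iter t T (env v)) x0).
  exact: (measurableT_comp (measurable_chain_op1 Q mf fM n x0) (@measurable_env_iter t)).
have mcX : measurable_fun setT (fun v => chain_op Q n f (iter t T (env v)) (X t v)).
  have mp : measurable_fun setT (fun v => (iter t T (env v), X t v)).
    by apply: measurable_fun_pair => //; exact: (@measurable_env_iter t).
  exact: (measurableT_comp (measurable_chain_op Q mf fM n) mp).
have bcx y x : `|chain_op Q n f y x| <= M by exact: chain_op_bounded.
have intM (g : Omega -> R) : measurable_fun setT g -> (forall v, `|g v| <= M) ->
    P.-integrable setT (EFin \o (fun v => D v * g v)).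
  move=> mg gM; apply: (bounded_integrable P1 (M := N * M)).
    exact: measurable_funM.
  by move=> v; rewrite normrM ler_pM.
have -> : \int[P]_v (D v * (f (X (t + n)%N v) - chain_op Q n f (iter t T (env v)) x0)) =
    \int[P]_v (D v * (chain_op Q n f (iter t T (env v)) (X t v) -
                      chain_op Q n f (iter t T (env v)) x0)).
  under eq_Rintegral do rewrite mulrBr.
  under [RHS]eq_Rintegral do rewrite mulrBr.
  rewrite !RintegralB//; try exact: intM.
  by rewrite (@Rintegral_chain_op n f M t D N mf fM mD DN).
pose g (v : Omega) := D v * (chain_op Q n f (iter t T (env v)) (X t v) -
  chain_op Q n f (iter t T (env v)) x0).
rewrite -[X in `|X|]/(\int[P]_v g v).
have mg : measurable_fun setT g by apply: measurable_funM => //; exact: measurable_funB.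
have gb v : `|g v| <= N * (2 * M).
  rewrite normrM ler_pM// (le_trans (ler_normB _ _))//.
  by rewrite mulr_natl mulr2n lerD.
pose h y := prodr n (iter t T y).
have mprod := measurable_orbit_prod mT mrho n.
have mh : measurable_fun setT h by exact: measurableT_comp mprod (measurable_iter mT t).
have h01 y : 0 <= h y <= 1 by exact: orbit_prod01.
have hb y : `|h y| <= 1 by have /andP[? ?] := h01 y; rewrite ger0_norm.
have h0 y : 0 <= h y by have /andP[] := h01 y.
have Eh : \int[P]_v h (env v) = r n.
  rewrite -(Rintegral_env_law Y mh hb) /mean_rate.
  apply: (Rintegral_preserving_iter mT PYshift t (f := prodr n) (M := 1)) => // y.
  by have /andP[? ?] := orbit_prod01 T rho01 n y; rewrite ger0_norm.
have mhe : measurable_fun setT (fun v => h (env v)).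
  exact: measurableT_comp mh (measurable_env_path Y).
rewrite -lee_fin EFin_normr_Rintegral//; last exact: bounded_integrable P1 mg gb.
apply: le_trans (le_abse_integral _ _ _) _ => //; first exact/measurable_EFinP.
pose a v := h (env v) * (w (iter t T (env v)) * V (X t v)).
have ma : measurable_fun setT a by apply: measurable_funM => //; exact: measurable_wV.
have a0 v : 0 <= a v by rewrite !mulr_ge0.
pose C := 2 * M * N.
have C0 : 0 <= C by rewrite !mulr_ge0.
apply: (@le_trans _ _ (\int[P]_v (C%:E * ((1 + V x0) * h (env v) + a v)%:E))%E).
  apply: ge0_le_integral => //.
  - by apply: measurableT_comp => //; exact/measurable_EFinP.
  - apply/measurable_EFinP; apply: measurable_funM => //.
    by apply: measurable_funD => //; exact: measurable_funM.
  move=> v _; rewrite -EFinM lee_fin /g normrM.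
  have := chain_op_contraction V_ge0 iV QV alpha01 minor w_ge0 rho01 inside
    outside n (iter t T (env v)) (X t v) x0 mf fM.
  rewrite -/(h (env v)) => hc.
  have c1 : `|D v| * `|chain_op Q n f (iter t T (env v)) (X t v) -
      chain_op Q n f (iter t T (env v)) x0| <=
      N * (2 * M * h (env v) * (1 + w (iter t T (env v)) * (V (X t v) + V x0))).
    by apply: ler_pM.
  apply: le_trans c1 _.
  rewrite (_ : N * _ = C * (h (env v) + h (env v) * (w (iter t T (env v)) * V x0) + a v));
    last by rewrite /a /C; ring.
  rewrite ler_wpM2l// lerD2r mulrDl mul1r lerD2l mulrC ler_wpM2r//.
  by rewrite ler_piMl.
rewrite ge0_integralZl//; last 2 first.
- apply/measurable_EFinP; apply: measurable_funD => //; exact: measurable_funM.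
- by move=> v _; rewrite lee_fin addr_ge0// mulr_ge0// addr_ge0.
under eq_integral do rewrite EFinD.
rewrite ge0_integralD//; last 4 first.
- by move=> v _; rewrite lee_fin mulr_ge0// addr_ge0.
- by apply/measurable_EFinP; exact: measurable_funM.
- by move=> v _; rewrite lee_fin.
- exact/measurable_EFinP.
have -> : (\int[P]_v ((1 + V x0) * h (env v))%:E = ((1 + V x0) * r n)%:E)%E.
  under eq_integral do rewrite EFinM.
  rewrite ge0_integralZl//; last 3 first.
  - exact/measurable_EFinP.
  - by move=> v _; rewrite lee_fin.
  - by rewrite lee_fin addr_ge0.
  by rewrite (bounded_fin_num_integral P1 mhe (fun v => hb (env v))) Eh.
have := expectation_weight t mh h01; rewrite Eh -/a => ea.
apply: (@le_trans _ _ (C%:E * (((1 + V x0) * r n)%:E + ((V x0 + B) * r n)%:E))%E).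
  by apply: lee_wpmul2l; [rewrite lee_fin|rewrite leeD2l].
rewrite -EFinD -EFinM lee_fin le_eqVlt; apply/orP; left; apply/eqP.
by rewrite /dec_cst /C; ring.
Qed.

Section lag.
Variable m : nat.

Let dev k (v : Omega) : R := f (X (k + m)%N v) - chain_op Q m f (iter k T (env v)) x0.

Let S p (v : Omega) : R := \sum_(0 <= k < p) dev k v.

Let dev_bounded k v : `|dev k v| <= 2 * M.
Proof.
rewrite (le_trans (ler_normB _ _))// mulr_natl mulr2n lerD//.
exact: chain_op_bounded.
Qed.

Let measurable_dev k t : (k + m <= t)%N ->
  measurable_fun setT (fun v : past t => dev k v).
Proof.
move=> kt; apply: measurable_funB.
  exact: (measurableT_comp mf (@measurable_past_X _ _ _ _ _ _ _ P Y X t _ kt)).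
exact: (measurableT_comp (measurable_chain_op1 Q mf fM m x0) (@measurable_past_iter k t)).
Qed.

Let measurable_devO k : measurable_fun setT (dev k).
Proof.
exact: (measurableT_comp (measurable_dev (leqnn (k + m)))
  (measurable_past_id Y X (k + m)%N)).
Qed.

Let S_dist p q v : (p <= q)%N -> `|S q v - S p v| <= 2 * M * (q - p)%:R.
Proof.
move=> pq; rewrite /S (big_cat_nat _ pq)//= addrAC subrr add0r.
rewrite (le_trans (ler_norm_sum _ _ _))//.
apply: (@le_trans _ _ (\sum_(p <= k < q) 2 * M)); first by apply: ler_sum.
by rewrite sumr_const_nat mulr_natr.
Qed.

Let S_bounded p v : `|S p v| <= 2 * M * p%:R.
Proof. by have := S_dist v (leq0n p); rewrite {2}/S big_geq// subr0 subn0. Qed.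

Let measurable_SO p : measurable_fun setT (S p).
Proof. by apply: measurable_sum => k; exact: measurable_devO. Qed.

(* S (p - m) only involves the past at time p, so it decorrelates from dev p; the
   remaining at most m terms of S p are bounded trivially. *)
Lemma second_moment_bound p :
  \int[P]_v (S p v ^+ 2) <=
    p%:R ^+ 2 * (4 * M ^+ 2 * dec_cst * r m) + p%:R * (4 * M ^+ 2 * (2 * m%:R + 1)).
Proof.
have M2 : 0 <= 2 * M by rewrite mulr_ge0.
have r0 : 0 <= r m.
  by apply: Rintegral_ge0 => y _; have /andP[] := orbit_prod01 T rho01 m y.
set eta := 4 * M ^+ 2 * dec_cst * r m.
have eta0 : 0 <= eta by rewrite !mulr_ge0// exprn_ge0.
elim: p => [|p IH].
  have -> : \int[P]_v (S 0 v ^+ 2) = 0.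
    rewrite -[RHS](Rintegral_cst1 0 P1); apply: eq_Rintegral => v _.
    by rewrite /S big_geq// expr0n.
  by rewrite expr0n/= !mul0r addr0.
have iSS (p1 p2 : nat) : P.-integrable setT (EFin \o (fun v => S p1 v * dev p2 v)).
  apply: (bounded_integrable P1 (M := 2 * M * p1%:R * (2 * M))).
    exact: measurable_funM.
  by move=> v; rewrite normrM ler_pM.
have i2 : P.-integrable setT (EFin \o (fun v => S p v ^+ 2)).
  apply: (bounded_integrable P1 (M := (2 * M * p%:R) ^+ 2)).
    exact: measurable_funX.
  by move=> v; rewrite normrX lerXn2r// nnegrE// mulr_ge0.
have id2 : P.-integrable setT (EFin \o (fun v => dev p v ^+ 2)).
  apply: (bounded_integrable P1 (M := (2 * M) ^+ 2)).
    exact: measurable_funX.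
  by move=> v; rewrite normrX lerXn2r// nnegrE.
have cross : \int[P]_v (S p v * dev p v) <= p%:R * eta + 4 * M ^+ 2 * m%:R.
  (* Indices k < p - m satisfy k + m <= p, so these terms are known at time p. For p < m the
     truncated subtraction leaves an empty sum, and the missing part still has at most m terms. *)
  have mS : measurable_fun setT (fun v : past p => S (p - m) v).
    rewrite /S; under eq_fun do rewrite big_mkord.
    apply: measurable_sum => k; apply: measurable_dev.
    by have := ltn_ord k; rewrite ltn_subRL addnC; exact: ltnW.
  have pm : ((p - m)%:R : R) <= p%:R by rewrite ler_nat leq_subr.
  have bS v : `|S (p - m) v| <= 2 * M * p%:R.
    by rewrite (le_trans (S_bounded _ _))// ler_wpM2l.
  have := decorrelation m mS bS; rewrite ler_norml => /andP[_ d1].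
  have d2 : \int[P]_v (S p v * dev p v) - \int[P]_v (S (p - m) v * dev p v) <=
      4 * M ^+ 2 * m%:R.
    rewrite -RintegralB//.
    rewrite -[leRHS](Rintegral_cst1 _ P1); apply: le_Rintegral => //.
    - exact: (integrableB measurableT (iSS p p) (iSS (p - m)%N p)).
    - exact: (bounded_integrable P1 (M := `|4 * M ^+ 2 * m%:R|)).
    move=> v _; rewrite -mulrBl (le_trans (ler_norm _))// normrM.
    apply: (@le_trans _ _ (2 * M * m%:R * (2 * M))).
      apply: ler_pM => //; rewrite (le_trans (S_dist _ (leq_subr _ _)))//.
      by rewrite ler_wpM2l// ler_nat leq_subLR addnC -leq_subLR.
    by rewrite le_eqVlt; apply/orP; left; apply/eqP; ring.
  have d3 : 2 * M * (2 * M * p%:R) * dec_cst * r m = p%:R * eta by rewrite /eta; ring.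
  by move: d1 d2; rewrite d3 -/(dev p _); lra.
have sq : \int[P]_v (dev p v ^+ 2) <= 4 * M ^+ 2.
  rewrite -[leRHS](Rintegral_cst1 _ P1); apply: le_Rintegral => //.
    exact: (bounded_integrable P1 (M := `|4 * M ^+ 2|)).
  move=> v _; rewrite -real_normK ?num_real// (_ : 4 * M ^+ 2 = (2 * M) ^+ 2); last by ring.
  by rewrite lerXn2r// nnegrE.
have -> : \int[P]_v (S p.+1 v ^+ 2) = \int[P]_v (S p v ^+ 2) +
    (2 * \int[P]_v (S p v * dev p v) + \int[P]_v (dev p v ^+ 2)).
  rewrite -RintegralZl// -RintegralD//; last first.
    rewrite [X in _.-integrable _ X](_ : _ =
      fun v => (2%:E * (EFin \o (fun v => S p v * dev p v)%R) v)%E)//.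
    exact: integrableZl.
  rewrite -RintegralD//; last first.
    apply: (bounded_integrable P1 (M := 2 * (2 * M * p%:R * (2 * M)) + (2 * M) ^+ 2)).
      by apply: measurable_funD; [apply: measurable_funM => //; exact: measurable_funM
                                 |exact: measurable_funX].
    move=> v; rewrite (le_trans (ler_normD _ _))// lerD//.
      by rewrite normrM ger0_norm// ler_wpM2l// normrM ler_pM.
    by rewrite normrX lerXn2r// nnegrE.
  by apply: eq_Rintegral => v _; rewrite {1}/S big_nat_recr//= -/(S p v); ring.
(* The increment is at most 2 p eta + 4 M^2 (2 m + 1), and 2 p <= (p + 1)^2 - p^2. *)
rewrite -natr1; move: IH cross sq; rewrite -/eta.
move: (\int[P]_v (S p v ^+ 2)) (\int[P]_v (S p v * dev p v)) (\int[P]_v (dev p v ^+ 2)).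
by move=> q c e; lra.
Qed.

End lag.

Hypothesis erg : forall A : set pathT, measurable A -> T @^-1` A = A ->
  env_law Y A = 0%E \/ env_law Y A = 1%E.

Hypothesis r0 : r n @[n --> \oo] --> (0 : R).

(** The error splits into boundary terms from shifting the sum by m, the centred sum S / n, the
    ergodic average of g around its mean, and the bias of that mean. The bounds below add up to at
    most e / 8 + 3 (e / 4). *)
Lemma lln_L1 (ell C : R) :
  (forall n, `|annealed_law Q (env_law Y) n f x0 - ell| <= C * r n) ->
  \int[P]_v `|(\sum_(1 <= k < n.+1) f (X k v)) / n%:R - ell| @[n --> \oo] --> (0 : R).
Proof.
move=> hell; apply/cvgrPdist_le => e e0.
have M2 : 0 <= 2 * M by rewrite mulr_ge0.
have r_ge0 n : 0 <= r n.
  by apply: Rintegral_ge0 => y _; have /andP[] := orbit_prod01 T rho01 n y.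
pose A := 4 * M ^+ 2 * dec_cst.
have A0 : 0 <= A by rewrite !mulr_ge0// exprn_ge0.
(* These are the two contributions that do not vanish as n grows: the bias, and the leading part of
   the second moment of S / n multiplied by 2 / e. *)
have [m hm] : exists m, (C + A * (2 / e)) * r m <= e / 4.
  have c : (C + A * (2 / e)) * r n @[n --> \oo] --> (C + A * (2 / e)) * 0.
    by apply: cvgM => //; exact: cvg_cst.
  rewrite mulr0 in c; have e4 : 0 < e / 4 by lra.
  have /cvgrPdist_le /(_ _ e4) [m _ /(_ m (leqnn m))] := c.
  by rewrite sub0r normrN => /(le_trans (ler_norm _)) ?; exists m.
pose g y := chain_op Q m f y x0.
have mg : measurable_fun setT g by exact: measurable_chain_op1 mf fM _ _.
have gM y : `|g y| <= M by exact: chain_op_bounded mf fM _ _ _.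
pose a := \int[env_law Y]_y g y.
have aell : `|a - ell| <= C * r m by exact: hell.
pose c := 4 * M ^+ 2 * (2 * m%:R + 1).
(* D collects the contributions of order 1 / n: boundary terms and the linear part of the second
   moment. *)
pose D := 2 * M * (m%:R + 1) + c * (2 / e).
have e4 : 0 < e / 4 by lra.
have /cvgrPdist_le /(_ _ e4) [N1 _ HN1] := ergodic_L1 mT PYshift erg mg gM.
pose N2 := Num.bound `|D / (e / 4)|.
exists (maxn N1 N2.+1) => // n /=; rewrite geq_max => /andP[n1 n2].
have n0 : 0 < (n%:R : R) by rewrite ltr0n (leq_trans _ n2).
have Dn : D / n%:R <= e / 4.
  rewrite ler_pdivrMr// mulrC -ler_pdivrMr//.
  by rewrite ltW// (lt_trans (lt_archi_bound _))// ltr_nat.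
rewrite sub0r normrN ger0_norm; last by apply: Rintegral_ge0.
pose S (v : Omega) := \sum_(0 <= k < n)
  (f (X (k + m)%N v) - chain_op Q m f (iter k T (env v)) x0).
have mS : measurable_fun setT S.
  apply: measurable_sum => k; apply: measurable_funB; first exact: measurableT_comp.
  exact: (measurableT_comp mg (@measurable_env_iter k)).
have SM v : `|S v| <= 2 * M * n%:R.
  rewrite (le_trans (ler_norm_sum _ _ _))//.
  apply: (@le_trans _ _ (\sum_(0 <= k < n) 2 * M)); last first.
    by rewrite sumr_const_nat subn0 mulr_natr.
  apply: ler_sum => k _; rewrite (le_trans (ler_normB _ _))//.
  by rewrite mulr_natl mulr2n lerD// gM.
pose G1 v := S v ^+ 2 / (n%:R ^+ 2 * (e / 2)).
pose G2 v := `|orbit_sum T g n (env v) / n%:R - a|.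
pose k0 := 2 * M * (m%:R + 1) / n%:R + e / 8 + C * r m.
(* Each unit shift of the window telescopes to two boundary terms. One shift aligns the index range
   1..n with 0..n-1, and m more produce the lag. *)
have shift_sum v : `|\sum_(1 <= k < n.+1) f (X k v) -
    \sum_(0 <= k < n) f (X (k + m)%N v)| <= 2 * M * (m%:R + 1).
  pose t j := \sum_(0 <= k < n) f (X (k + j)%N v).
  have tS j : `|t j.+1 - t j| <= 2 * M.
    rewrite /t -sumrB (eq_bigr (fun k => f (X (k.+1 + j)%N v) - f (X (k + j)%N v))).
      rewrite (telescope_sumr (fun k => f (X (k + j)%N v)))//.
      by rewrite (le_trans (ler_normB _ _))// mulr_natl mulr2n lerD.
    by move=> k _; rewrite addnS addSn.
  have t0 j : `|t j - t 0%N| <= 2 * M * j%:R.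
    elim: j => [|j IH]; first by rewrite subrr normr0 mulr0.
    rewrite -(subrKA (t j)) (le_trans (ler_normD _ _))// -[j.+1%:R]natr1 mulrDr mulr1 addrC.
    by rewrite lerD.
  rewrite (_ : \sum_(1 <= k < n.+1) _ = t 1%N); last first.
    by rewrite big_add1; apply: eq_bigr => k _; rewrite addn1.
  rewrite -/(t m) -(subrKA (t 0%N)) (le_trans (ler_normD _ _))//.
  rewrite mulrDr mulr1 addrC lerD//.
  by rewrite distrC.
have pointwise v : `|(\sum_(1 <= k < n.+1) f (X k v)) / n%:R - ell| <=
    k0 + (G1 v + G2 v).
  (* Expanding (x - e / 4)^2 (2 / e) >= 0 passes from the second moment to the first pointwise, in
     place of the Cauchy-Schwarz inequality. *)
  have Se : `|S v / n%:R| <= e / 8 + G1 v.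
    pose x := `|S v / n%:R|.
    have -> : G1 v = x ^+ 2 * (2 / e).
      rewrite /x real_normK ?num_real// /G1; field.
      by rewrite !gt_eqF.
    have : 0 <= (x - e / 4) ^+ 2 * (2 / e) by rewrite mulr_ge0 ?sqr_ge0// divr_ge0// ltW.
    have -> : (x - e / 4) ^+ 2 * (2 / e) = x ^+ 2 * (2 / e) - x + e / 8.
      by field; rewrite gt_eqF.
    by rewrite -/x; lra.
  have -> : (\sum_(1 <= k < n.+1) f (X k v)) / n%:R - ell =
      (\sum_(1 <= k < n.+1) f (X k v) - \sum_(0 <= k < n) f (X (k + m)%N v)) / n%:R +
      (S v / n%:R + ((orbit_sum T g n (env v) / n%:R - a) + (a - ell))).
    have -> : S v = \sum_(0 <= k < n) f (X (k + m)%N v) - orbit_sum T g n (env v).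
      by rewrite /S sumrB.
    by field; rewrite gt_eqF.
  rewrite (le_trans (ler_normD _ _))//.
  have h1 : `|(\sum_(1 <= k < n.+1) f (X k v) -
      \sum_(0 <= k < n) f (X (k + m)%N v)) / n%:R| <= 2 * M * (m%:R + 1) / n%:R.
    by rewrite normrM normfV (ger0_norm (ltW n0)) ler_wpM2r// invr_ge0 ltW.
  have h2 := ler_normD (S v / n%:R) ((orbit_sum T g n (env v) / n%:R - a) + (a - ell)).
  have h3 := ler_normD (orbit_sum T g n (env v) / n%:R - a) (a - ell).
  by move: h1 h2 h3 Se aell; rewrite /k0 -/(G2 v); lra.
have mG1 : measurable_fun setT G1 by apply: measurable_funM => //; exact: measurable_funX.
have mo : measurable_fun setT (fun y => `|orbit_sum T g n y / n%:R - a|).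
  apply: measurableT_comp => //; apply: measurable_funB => //.
  by apply: measurable_funM => //; exact: measurable_orbit_sum.
have bo y : `| `|orbit_sum T g n y / n%:R - a| | <= 2 * M.
  rewrite normr_id (le_trans (ler_normB _ _))// mulr_natl mulr2n lerD//.
    rewrite normrM normfV (ger0_norm (ltW n0)) ler_pdivrMr// mulr_natr.
    exact: orbit_sum_bounded.
  exact: Rintegral_bounded (probability_setT _) mg gM.
have mG2 : measurable_fun setT G2 by exact: (measurableT_comp mo (measurable_env_path Y)).
have iG1 : P.-integrable setT (EFin \o G1).
  apply: (bounded_integrable P1 mG1 (M := (2 * M * n%:R) ^+ 2 / (n%:R ^+ 2 * (e / 2)))).
  move=> v; have q0 : 0 <= (n%:R ^+ 2 * (e / 2))^-1.
    by rewrite invr_ge0 mulr_ge0 ?exprn_ge0//; lra.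
  rewrite normrM (ger0_norm q0) ler_wpM2r// normrX lerXn2r// nnegrE//.
  by rewrite mulr_ge0// ltW.
have iG2 : P.-integrable setT (EFin \o G2).
  exact: (bounded_integrable P1 mG2 (fun v => bo (env v))).
have iG12 : P.-integrable setT (EFin \o (fun v => G1 v + G2 v)).
  exact: (integrableD measurableT iG1 iG2).
have ik0 : P.-integrable setT (EFin \o cst k0).
  exact: (bounded_integrable P1 (M := `|k0|)).
have mavg : measurable_fun setT
    (fun v => `|(\sum_(1 <= k < n.+1) f (X k v)) / n%:R - ell|).
  apply: measurableT_comp => //; apply: measurable_funB => //.
  apply: measurable_funM => //; apply: measurable_sum => k.
  exact: measurableT_comp.
apply: (@le_trans _ _ (\int[P]_v (k0 + (G1 v + G2 v)))).
  apply: le_Rintegral => //; last exact: (integrableD measurableT ik0 iG12).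
  apply: (bounded_integrable P1 mavg (M := 1 * M * n%:R / n%:R + `|ell|)) => v.
  rewrite normr_id (le_trans (ler_normB _ _))// lerD2r.
  rewrite normrM normfV (ger0_norm (ltW n0)) ler_wpM2r ?invr_ge0 ?(ltW n0)//.
  rewrite (le_trans (ler_norm_sum _ _ _))//.
  apply: (@le_trans _ _ (\sum_(1 <= k < n.+1) M)); first by apply: ler_sum.
  by rewrite sumr_const_nat subn1 mul1r mulr_natr.
rewrite RintegralD//.
rewrite Rintegral_cst1// RintegralD//.
have E2 : \int[P]_v G2 v <= e / 4.
  rewrite /G2 -(Rintegral_env_law Y mo bo).
  have := HN1 n n1; rewrite sub0r normrN => /(le_trans (ler_norm _)) /le_trans; apply.
  exact: lexx.
have E1 : \int[P]_v G1 v <= A * (2 / e) * r m + c * (2 / e) / n%:R.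
  have -> : \int[P]_v G1 v = (\int[P]_v (S v ^+ 2)) / (n%:R ^+ 2 * (e / 2)).
    rewrite -RintegralZr//.
    apply: (bounded_integrable P1 (M := (2 * M * n%:R) ^+ 2)).
      exact: measurable_funX.
    move=> v; rewrite normrX lerXn2r// nnegrE//.
    by rewrite mulr_ge0// ltW.
  have q0 : 0 < n%:R ^+ 2 * (e / 2) by rewrite mulr_gt0 ?exprn_gt0//; lra.
  rewrite ler_pdivrMr//; apply: (le_trans (second_moment_bound m n)).
  rewrite -/A -/c le_eqVlt; apply/orP; left; apply/eqP; field.
  by rewrite !gt_eqF.
have DE : D / n%:R = 2 * M * (m%:R + 1) / n%:R + c * (2 / e) / n%:R.
  by rewrite /D mulrDl.
have hm' : C * r m + A * (2 / e) * r m <= e / 4 by rewrite -mulrDl.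
move: Dn hm' E1 E2; rewrite DE /k0.
move: (2 * M * _ / n%:R) (c * (2 / e) / n%:R) (C * r m) (A * (2 / e) * r m).
move=> x1 x2 x3 x4; move: (\int[P]_v G1 v) (\int[P]_v G2 v) => x5 x6 *.
by lra.
Qed.

End observable.

End stationary.

End chain_in_random_environment.

(** * Convergence *)

Section moment_bounds.
Context (R : realType).
Local Open Scope ereal_scope.

Lemma limn_esup_lt_near (u : (\bar R)^nat) (x : \bar R) : limn_esup u < x ->
  exists N, forall n, (N <= n)%N -> u n < x.
Proof.
rewrite limn_esup_lim => ux.
have cu : esups u @ \oo --> ereal_inf (range (esups u)).
  exact: ereal_nonincreasing_cvgn (nonincreasing_esups u).
have {}ux : ereal_inf (range (esups u)) < x by rewrite -(cvg_lim _ cu).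
have [_ [N _ <-] uN] := ereal_inf_lt ux.
exists N => n Nn; apply: le_lt_trans uN.
by apply: ereal_sup_ubound; exists n.
Qed.

Lemma poweR_root_le (x : \bar R) (s r : R) : (0 < r)%R -> (0 <= s)%R -> 0 <= x ->
  x `^ (r^-1) <= s%:E -> x <= (s `^ r)%:E.
Proof.
move=> r0 s0 x0 xs.
have rn0 : r != 0%R by rewrite gt_eqF.
rewrite -[leLHS]poweRe1// -(mulVf rn0) poweRrM -poweR_EFin.
apply: gt0_ler_poweR => //; first exact: ltW.
  by rewrite in_itv/= leey andbT poweR_ge0.
by rewrite in_itv/= leey andbT lee_fin.
Qed.

Lemma geometric_moment_bound (g : (\bar R)^nat) (s : R) : (0 < s)%R ->
  (forall n, 0 <= g n) -> limn_esup (fun n => g n `^ (n%:R^-1)%R) < s%:E ->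
  exists N, forall n, (N <= n)%N -> g n <= (s ^+ n)%:E.
Proof.
(* The successor keeps n positive, so that the exponent 1 / n can be inverted. *)
move=> s0 g0 /limn_esup_lt_near[N hN]; exists N.+1 => n Nn.
have n0 : (0 < n%:R :> R)%R by rewrite ltr0n (leq_trans _ Nn).
rewrite -powR_mulrn ?(ltW s0)//; apply: poweR_root_le => //; first exact: ltW.
by rewrite ltW// hN// ltnW.
Qed.

(* [exp (- r) <= 1 / r] turns the stretched exponential decay into a power one. *)
Lemma stretched_moment_bound (g : (\bar R)^nat) (theta : R) : (0 < theta)%R ->
  (forall n, 0 <= g n) ->
  g n `^ ((n%:R `^ theta)^-1)%R @[n --> \oo] --> 0 ->
  exists N, forall n, (N <= n)%N -> g n <= ((n%:R `^ theta)^-1)%:E.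
Proof.
move=> th0 g0 cg.
have [N _ hN] : \forall n \near \oo, g n `^ ((n%:R `^ theta)^-1)%R < (expR (-1))%:E.
  have [fin fc] := (fine_cvgP _ _).1 cg.
  have /cvgrPdist_lt /(_ _ (expR_gt0 (-1))) := fc.
  apply: filterS2 fin => n fn /=; rewrite sub0r normrN => /(le_lt_trans (ler_norm _)).
  by rewrite -lte_fin fineK.
exists N.+1 => n Nn.
have n0 : (0 < n%:R :> R)%R by rewrite ltr0n (leq_trans _ Nn).
have r0 : (0 < n%:R `^ theta :> R)%R by rewrite powR_gt0.
apply: (@le_trans _ _ (expR (-1) `^ (n%:R `^ theta))%:E).
  apply: poweR_root_le => //.
  by rewrite ltW// hN//= ltnW.
rewrite lee_fin -expRM mulN1r expRN lef_pV2 ?posrE ?expR_gt0//.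
by rewrite (le_trans _ (expR_ge1Dx _))// lerDr.
Qed.

End moment_bounds.

(** * Criteria for convergence in total variation and in Lp *)

Section convergence_criteria.
Context (R : realType) d (S : measurableType d).

(** On a Hahn decomposition the total variation is the difference of the charge on the positive part
    and on the negative part; each is bounded by del, whence the factor 2. *)
Lemma dTV_le (m1 m2 : probability S R) (del : R) :
  (forall B, measurable B -> `|fine (m1 B) - fine (m2 B)| <= del) ->
  (0 <= dTV m1 m2 <= (2 * del)%:E)%E.
Proof.
move=> h; rewrite /dTV /Defs.total_variation.
case: (cid (Hahn_decomposition (charge_diff m1 m2))) => A hA; case: (cid hA) => N nuAN.
have diffE D : measurable D -> charge_diff m1 m2 D = (fine (m1 D) - fine (m2 D))%:E.
  move=> mD; rewrite /charge_diff /cadd /= /copp /=.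
  by rewrite EFinB !fineK ?fin_num_measure.
have [mA _] := let: And4 (conj mA _) _ _ _ := nuAN in conj mA I.
have [mN _] := let: And4 _ (conj mN _) _ _ := nuAN in conj mN I.
apply/andP; split; first by rewrite /charge_variation/=; exact: adde_ge0.
rewrite /charge_variation/= mulr_natl mulr2n EFinD leeD//.
  rewrite jordan_posE cjordan_posE /crestr0 mem_set// /crestr setTI diffE// lee_fin.
  by rewrite (le_trans (ler_norm _))// h.
rewrite jordan_negE cjordan_negE /crestr0 mem_set// /crestr setTI diffE// -EFinN lee_fin.
by rewrite (le_trans (ler_norm _))// normrN h.
Qed.

(** For bounded Z, |Z|^p is at most a constant times |Z|. The constant uses |M| + 1 so as to be
    positive, since it is divided by below. *)
Lemma Lnorm_cvg0 (P : probability S R) (Z : nat -> S -> R) (M p : R) :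
  (forall n, measurable_fun setT (Z n)) -> (forall n x, `|Z n x| <= M) -> 1 <= p ->
  \int[P]_x `|Z n x| @[n --> \oo] --> (0 : R) ->
  'N[P]_p%:E[(fun x => (Z n x)%:E)]%E @[n --> \oo] --> 0%E.
Proof.
move=> mZ ZM p1 cZ.
have p0 : 0 < p by rewrite (lt_le_trans ltr01).
have P1 : P setT = 1%E by exact: probability_setT.
pose C := (`|M| + 1) `^ (p - 1).
have C0 : 0 < C by rewrite powR_gt0// ltr_wpDl.
have bound n : ('N[P]_p%:E[(fun x => (Z n x)%:E)] <=
    ((C * \int[P]_x `|Z n x|) `^ p^-1)%:E)%E.
  rewrite unlock -poweR_EFin; apply: gt0_ler_poweR; first by rewrite invr_ge0 ltW.
  - by rewrite in_itv/= leey andbT; apply: integral_ge0 => x _; rewrite ?lee_fin ?powR_ge0.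
  - by rewrite in_itv/= leey andbT lee_fin mulr_ge0 ?(ltW C0)// Rintegral_ge0.
  have mn : measurable_fun setT (fun x => `|Z n x|) by exact: measurableT_comp.
  have zn x : `| `|Z n x| | <= M by rewrite normr_id.
  rewrite EFinM -(bounded_fin_num_integral P1 mn zn) -ge0_integralZl//; last 2 first.
  - exact/measurable_EFinP.
  - by rewrite lee_fin ltW.
  apply: ge0_le_integral => //.
  - by move=> x _; exact: poweR_ge0.
  - by apply/measurable_EFinP; exact: (measurableT_comp (measurable_powR p) mn).
  - by apply/measurable_EFinP; exact: measurable_funM.
  move=> x _; rewrite -EFinM lee_fin.
  have [->|z0] := eqVneq (Z n x) 0; first by rewrite normr0 powR0 ?gt_eqF// mulr0.
  rewrite -[in leLHS](subrK 1 p) powRD; last by apply/implyP => _; rewrite normr_eq0.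
  rewrite powRr1// ler_wpM2r// /C ge0_ler_powR ?nnegrE ?subr_ge0//.
  by rewrite (le_trans (ZM n x))// (le_trans (ler_norm M))// lerDl.
apply: (@squeeze_cvge _ _ _ _ (cst 0%E) _
  (fun n => ((C * \int[P]_x `|Z n x|) `^ p^-1)%:E)).
- by apply: nearW => n; rewrite Lnorm_ge0 bound.
- exact: cvg_cst.
apply: cvg_EFin; first exact: nearW.
apply/cvgrPdist_le => e e0.
have ep : 0 < e `^ p / C by rewrite divr_gt0// powR_gt0.
have /cvgrPdist_le /(_ _ ep) := cZ; apply: filterS => n /=.
rewrite !sub0r !normrN ger0_norm; last by apply: Rintegral_ge0.
rewrite ler_pdivlMr// mulrC => hn.
rewrite ger0_norm ?powR_ge0//.
have -> : e = (e `^ p) `^ p^-1 by rewrite -powRrM divff ?gt_eqF// powRr1// ltW.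
rewrite ge0_ler_powR ?invr_ge0 ?nnegrE ?powR_ge0 ?(ltW p0)//.
by rewrite mulr_ge0 ?(ltW C0)// Rintegral_ge0.
Qed.

End convergence_criteria.

Section annealed_set_function.
Context (R : realType) dX dY (Xsp : measurableType dX) (Ysp : measurableType dY).
Variables (Q : R.-pker (Ysp * Xsp)%type ~> Xsp) (PY : probability (pathT Ysp) R).

Let p1 : PY setT = 1%E. Proof. exact: probability_setT. Qed.

Let indic1 (A : set Xsp) x : `|\1_A x : R| <= 1.
Proof. by rewrite indicE; case: (_ \in _); rewrite ?normr1 ?normr0 ?ler01. Qed.

Let mind (A : set Xsp) : measurable A -> measurable_fun setT (\1_A : Xsp -> R).
Proof. by move=> mA; exact: measurable_indic. Qed.

Lemma annealed_law_ge0 n (A : set Xsp) x : 0 <= annealed_law Q PY n \1_A x.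
Proof. by apply: Rintegral_ge0 => y _; apply: chain_op_ge0 => z; rewrite indicE. Qed.

Lemma annealed_law_cst n c x : annealed_law Q PY n (cst c) x = c.
Proof.
rewrite /annealed_law -[RHS](Rintegral_cst1 c p1).
by apply: eq_Rintegral => y _; rewrite chain_op_cst.
Qed.

Lemma annealed_lawU n (A B : set Xsp) x : measurable A -> measurable B ->
  A `&` B = set0 ->
  annealed_law Q PY n \1_(A `|` B) x =
  annealed_law Q PY n \1_A x + annealed_law Q PY n \1_B x.
Proof.
move=> mA mB AB; rewrite /annealed_law -RintegralD//; last 2 first.
- apply: (bounded_integrable p1 (measurable_chain_op1 Q (mind mA) (indic1 A) n x)) => y.
  exact: chain_op_bounded (mind mA) (indic1 A) n y x.
- apply: (bounded_integrable p1 (measurable_chain_op1 Q (mind mB) (indic1 B) n x)) => y.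
  exact: chain_op_bounded (mind mB) (indic1 B) n y x.
apply: eq_Rintegral => y _.
rewrite -(chain_opD Q n y x (mind mA) (mind mB) (indic1 A) (indic1 B)).
congr (chain_op Q n _ y x); apply/funext => z; rewrite !indicE in_setU.
have [zA|] := boolP (z \in A); have [zB|] := boolP (z \in B);
  rewrite /= ?addr0 ?add0r//.
by exfalso; rewrite !inE in zA zB; have : set0 z by rewrite -AB.
Qed.

Lemma annealed_law_bigcup n (F : nat -> set Xsp) x : (forall i, measurable (F i)) ->
  annealed_law Q PY n \1_(\big[setU/set0]_(0 <= i < k) F i) x @[k --> \oo] -->
  annealed_law Q PY n \1_(\bigcup_i F i) x.
Proof.
move=> mF; have mU : measurable (\bigcup_i F i) by exact: bigcup_measurable.
have mUk k : measurable (\big[setU/set0]_(0 <= i < k) F i) by exact: bigsetU_measurable.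
apply: (bounded_cvg_Rintegral p1 (M := 1)).
- by move=> k; exact: measurable_chain_op1 (mind (mUk k)) (indic1 _) n x.
- exact: measurable_chain_op1 (mind mU) (indic1 _) n x.
- by move=> k y; exact: chain_op_bounded (mind (mUk k)) (indic1 _) n y x.
apply: aeW => y.
apply: (@chain_op_cvg _ _ _ _ _ Q n (fun k => \1_(\big[setU/set0]_(0 <= i < k) F i))
  \1_(\bigcup_i F i) 1 y x) => //.
move=> z.
apply: cvg_near_cst; rewrite indicE.
have [|] := boolP (z \in _); rewrite ?inE ?notin_setE.
  move=> [i _ Fi]; exists i.+1 => // k /= ik.
  rewrite indicE mem_set// big_mkord -bigcup_mkord.
  by exists i.
move=> nF; apply: nearW => k; rewrite indicE memNset// => h; apply: nF.
by move: h; rewrite big_mkord -bigcup_mkord => -[i _ Fi]; exists i.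
Qed.

End annealed_set_function.

Unset Implicit Arguments.

Theorem theorem2p10 (R : realType) (dO dX dY : measure_display)
    (Omega : measurableType dO) (Xsp : measurableType dX)
    (Ysp : measurableType dY) (P : probability Omega R)
    (Y : int -> {RV P >-> Ysp}) (Q : R.-pker (Ysp * Xsp)%type ~> Xsp)
    (V : Xsp -> R) (gamma K : Ysp -> R)
    (eps : R) (alpha : Ysp -> R) (kappa : R.-pker Ysp ~> Xsp) (theta : R) :
  standard_borel R Xsp ->
  strictly_stationary Y ->
  drift_condition Q V gamma K ->
  contractivity_condition Y gamma K ->
  minorization_condition Y Q V gamma K eps alpha kappa ->
  smallness_condition Y alpha theta ->
  exists mu : probability Xsp R,
    forall (x0 : Xsp) (X : nat -> {RV P >-> Xsp}),
      chain_in_environment Y Q x0 X ->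
      dTV (distribution P (X N)) mu @[N --> \oo] --> 0%E /\
      (ergodic_process Y ->
       forall Phi : Xsp -> R,
         measurable_fun setT Phi ->
         (exists M : R, forall x, `|Phi x| <= M) ->
         forall p : R, 1 <= p ->
           'N[P]_p%:E[(fun w =>
              ((\sum_(1 <= k < N.+1) Phi (X k w)) / N%:R
                 - \int[mu]_z Phi z)%:E)]%E
             @[N --> \oo] --> 0%E).
Proof.
move=> _ stat [[mV V0] [mgamma gamma0] [mK K1] drift] contr.
move=> [gb0 /andP[eps0 epsg] [malpha alpha01] minor] [/andP[theta0 theta1] small].
have P1 : P setT = 1%E by exact: probability_setT.
pose PY := env_law Y.
have PYshift h (A : set (pathT Ysp)) : measurable A -> PY (shift_by h @^-1` A) = PY A.
  by move=> mA; exact: stat.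
have gbfin : gamma_bar Y gamma K = (fine (gamma_bar Y gamma K))%:E.
  rewrite fineK// ge0_fin_numE; last exact: ltW.
  by rewrite (lt_trans contr) ?ltry.
set gb := fine _ in gbfin epsg.
have gbpos : 0 < gb by rewrite -lte_fin -gbfin.
have gb1 : gb < 1 by rewrite -lte_fin -gbfin.
(* The hypothesis gives 1 + eps < gb^(-1/2), and gb^(-1/2) < 1 / gb because gb < 1. *)
have gbe : gb < (1 + eps)^-1.
  have s0 : 0 < Num.sqrt gb by rewrite sqrtr_gt0.
  have s1 : Num.sqrt gb < 1 by rewrite -[ltRHS]sqrtr1 ltr_sqrt.
  have h : 1 + eps < (Num.sqrt gb)^-1 by lra.
  rewrite -[ltLHS]invrK ltf_pV2 ?posrE ?invr_gt0//; last lra.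
  apply: (lt_trans h); rewrite ltf_pV2 ?posrE//.
  by rewrite -[X in X < _](sqr_sqrtr (ltW gbpos)) expr2 gtr_pMl.
(* The points s' and sigma trisect the interval from gb to 1 / (1 + eps): s' serves the moment
   bound, sigma the weight. *)
pose s' := (2 * gb + (1 + eps)^-1) / 3.
pose sigma := (gb + 2 * (1 + eps)^-1) / 3.
have gbs' : gb < s' by rewrite /s'; lra.
have s'0 : 0 < s' by exact: lt_trans gbs'.
have s's : s' < sigma by rewrite /s' /sigma; lra.
have sigma0 : 0 < sigma by exact: lt_trans s's.
have sigmae : sigma < (1 + eps)^-1 by rewrite /sigma; lra.
have e1 : 0 < 1 + eps by lra.
have sigma_eps : sigma * (1 + eps) < 1 by rewrite -ltr_pdivlMr// mul1r.
have sigma1 : sigma < 1.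
  by apply: (lt_trans sigmae); rewrite invf_lt1//; lra.
have sigma01 : 0 < sigma < 1 by rewrite sigma0.
have menv := measurable_env_path Y.
have toPY (F : pathT Ysp -> R) : measurable_fun setT F -> (forall y, 0 <= F y) ->
    (\int[PY]_y (F y)%:E = 'E_P[(fun v => F (env_path Y v))])%E.
  move=> mF F0; rewrite unlock.
  rewrite (ge0_integral_pushforward menv)//;
    first [exact/measurable_EFinP|by move=> y _; rewrite lee_fin].
have [N1 HN1] : exists N, forall n, (N <= n)%N ->
    (\int[PY]_y (K (y 0) * \prod_(1 <= k < n.+1) gamma (y k%:Z))%:E <= (s' ^+ n)%:E)%E.
  pose F n (y : pathT Ysp) := K (y 0) * \prod_(1 <= k < n.+1) gamma (y k%:Z).
  have F0 n y : 0 <= F n y.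
    apply: mulr_ge0; first exact: le_trans ler01 _.
    by apply: prodr_ge0 => i _; exact: ltW.
  have mF n : measurable_fun setT (F n).
    apply: measurable_funM; first exact: measurableT_comp mK (measurable_coord _ 0).
    apply: measurable_prod => j _.
    exact: measurableT_comp mgamma (measurable_coord _ j%:Z).
  apply: (@geometric_moment_bound _ (fun n => \int[PY]_y (F n y)%:E)%E) => //.
    by move=> n; apply: integral_ge0 => y _; rewrite lee_fin.
  rewrite (_ : (fun n => _) = fun n =>
    ('E_P[(fun v => F n (env_path Y v))] `^ (n%:R^-1)%R)%E); last first.
    by apply/funext => n; rewrite toPY.
  by rewrite -[ltLHS]/(gamma_bar Y gamma K) gbfin lte_fin.
have [N2 HN2] : exists N, forall n, (N <= n)%N ->
    (\int[PY]_y (alpha (y 0) ^+ n)%:E <= ((n%:R `^ theta)^-1)%:E)%E.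
  have F0 n (y : pathT Ysp) : 0 <= alpha (y 0) ^+ n.
    by have /andP[a0 _] := alpha01 (y 0); rewrite exprn_ge0.
  have mF n : measurable_fun setT (fun y : pathT Ysp => alpha (y 0) ^+ n).
    by apply: measurable_funX; exact: measurableT_comp malpha (measurable_coord _ 0).
  apply: (@stretched_moment_bound _ (fun n => \int[PY]_y (alpha (y 0) ^+ n)%:E)%E) => //.
    by move=> n; apply: integral_ge0 => y _; rewrite lee_fin.
  rewrite [X in X @ _ --> _](_ : _ = fun n =>
    ('E_P[(fun v => alpha (Y 0 v) ^+ n)%R] `^ ((n%:R `^ theta)^-1)%R)%E)//.
  by apply/funext => n; rewrite toPY.
pose w := weight gamma K alpha sigma.
pose rho := rate gamma K alpha sigma eps.
have s's0 : 0 < s' < sigma by rewrite s'0.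
have w_pos : {ae PY, forall y, 0 < w y}.
  apply: (@weight_gt0 _ _ _ _ _ _ _ mgamma mK malpha gamma0 K1 alpha01 sigma0 PY PYshift
    s' theta (maxn N1 N2) s's0 theta0) => n; rewrite geq_max => /andP[? ?].
    exact: HN1.
  exact: HN2.
have rho01 := rate01 gamma0 K1 alpha01 sigma0 eps0 sigma_eps.
have mrho := measurable_rate mgamma mK malpha gamma0 K1 alpha01 sigma0 eps0.
have rho_lt1 : {ae PY, forall y, rho y < 1}.
  by apply: filterS w_pos => y; exact: rate_lt1.
have PYT := PYshift 1.
pose r n := mean_rate rho PY n.
have r_cvg : r n @[n --> \oo] --> (0 : R).
  exact: (cvg_orbit_prod (measurable_shift_by Ysp 1) PYT mrho rho01 rho_lt1).
have r_ge0 n : 0 <= r n.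
  by apply: Rintegral_ge0 => y _; have /andP[] := orbit_prod01 (shift_by 1) rho01 n y.
have iV q : (Q q).-integrable setT (EFin \o V).
  apply/integrableP; split; first exact/measurable_EFinP.
  under eq_integral do rewrite /= ger0_norm//.
  by case: q => y x; apply: le_lt_trans (drift x y) _; rewrite ltry.
have QV y x : \int[Q (y, x)]_z V z <= gamma y * V x + K y.
  rewrite -lee_fin /Rintegral fineK; first exact: drift.
  by apply: integrable_fin_num => //; exact: iV.
have minor' y x A : measurable A -> V x <= 2 * K y / (eps * gamma y) ->
    (1 - alpha y) * fine (kappa y A) <= fine (Q (y, x) A).
  move=> mA Vx; have [_ /(_ A mA) h] := minor y.
  have fin (B : {measure set Xsp -> \bar R}) : B setT = 1%E -> B A \is a fin_num.
    move=> B1; rewrite ge0_fin_numE// (le_lt_trans (_ : _ <= B setT)%E)//.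
      by rewrite le_measure ?inE.
    by rewrite B1 ltry.
  rewrite -lee_fin EFinM !fineK; try by apply: fin; exact: prob_kernel.
  apply: (le_trans h); apply: ereal_inf_lbound; exists x => //.
  by rewrite /small_set/= in_itv/= V0.
have w0 := weight_ge0 gamma0 K1 alpha01 sigma0.
have w1 y : w y <= 1.
  by rewrite (le_trans (weight_le4 gamma0 K1 alpha01 sigma0 y))//; lra.
have mw := measurable_weight mgamma mK malpha gamma0 K1 alpha01 sigma0.
have wd := weight_drift gamma0 K1 alpha01 sigma0.
have ins := rate_inside gamma0 K1 alpha01 sigma0 eps0 sigma_eps.
have out := rate_outside gamma0 K1 alpha01 sigma0 eps0 sigma_eps.
have B0 : 0 <= tightness_cst sigma := tightness_cst_ge0 sigma01.
have cauchy := annealed_law_cauchy V0 iV QV alpha01 minor' w0 w1 rho01 sigma01 wd ins out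
  PYT mrho.
have indic1 (A : set Xsp) x : `|\1_A x : R| <= 1.
  by rewrite indicE; case: (_ \in _); rewrite ?normr1 ?normr0 ?ler01.
have mind (A : set Xsp) : measurable A -> measurable_fun setT (\1_A : Xsp -> R).
  by move=> mA; exact: measurable_indic.
(* The limit is built from the chain started at [point], before any x0 or X is given, so it cannot
   depend on them. C0 is the Cauchy constant for indicators, where M = 1. *)
pose C0 := 2 * (1 + V point + tightness_cst sigma + V point).
have [mu muE] : exists mu : probability Xsp R, forall B n, measurable B ->
    `|fine (mu B) - annealed_law Q PY n \1_B point| <= C0 * r n.
  apply: (@setwise_limit R _ Xsp (fun n B => annealed_law Q PY n \1_B point)
    (fun n => C0 * r n)).
  - by move=> n B; exact: annealed_law_ge0.
  - by move=> n; rewrite indic0; exact: annealed_law_cst.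
  - by move=> n; rewrite indicT; exact: annealed_law_cst.
  - by move=> n A B; exact: annealed_lawU.
  - by move=> n F mF _; exact: annealed_law_bigcup.
  - move=> B m n mB nm; rewrite -(subnK nm).
    have := cauchy (m - n)%N n \1_B 1 point point (mind _ mB) (indic1 B).
    by rewrite mulr1.
  - rewrite -(mulr0 C0); apply: cvgM => //; exact: cvg_cst.
exists mu => x0 X chain.
have lawE n (f : Xsp -> R) M : measurable_fun setT f -> (forall x, `|f x| <= M) ->
    \int[distribution P (X n)]_z f z = annealed_law Q PY n f x0.
  move=> mf fM.
  have mX : measurable_fun setT (X n) by exact: measurable_funPT.
  have -> : \int[distribution P (X n)]_z f z = \int[P]_v f (X n v).
    rewrite /Rintegral (integral_pushforward mX)//; first exact/measurable_EFinP.
    rewrite preimage_setT; apply: (bounded_integrable P1 (M := M)) => //.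
    exact: measurableT_comp.
  (* The Markov property at time 0 with a trivial test function: conditioning on the environment
     alone, since X 0 is the constant x0. *)
  pose D1 : past Y X 0 -> R := cst 1.
  have mD1 : measurable_fun setT D1 by exact: measurable_cst.
  have D11 v : `|D1 v| <= 1 by rewrite /= normr1.
  have := Rintegral_chain_op chain n mf fM mD1 D11.
  rewrite add0n /D1 /=; under eq_Rintegral do rewrite mul1r.
  move=> ->; rewrite /annealed_law (Rintegral_env_law Y (M := M)).
  - by apply: eq_Rintegral => v _; rewrite mul1r chain.1.
  - exact: measurable_chain_op1 mf fM n x0.
  - by move=> y; exact: chain_op_bounded mf fM n y x0.
(* The first summand pays for moving the start from x0 to [point], the second for the distance from
   there to mu. *)
pose C1 := 2 * (1 + V point + tightness_cst sigma + V x0) + C0.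
have lawmu n B : measurable B ->
    `|fine (distribution P (X n) B) - fine (mu B)| <= C1 * r n.
  move=> mB; rewrite -(Rintegral_indic (distribution P (X n)) mB).
  rewrite (lawE n _ 1 (mind _ mB) (indic1 B)).
  have h1 := cauchy 0%N n \1_B 1 x0 point (mind _ mB) (indic1 B).
  have h2 := muE B n mB; rewrite distrC in h2.
  rewrite -(subrKA (annealed_law Q PY n \1_B point)) (le_trans (ler_normD _ _))//.
  rewrite /C1 mulrDl lerD//.
  by rewrite mulr1 in h1.
split.
  apply: (@squeeze_cvge _ _ _ _ (cst 0%E) _ (fun n => (2 * (C1 * r n))%:E)).
  - by apply: nearW => n; apply: dTV_le => B mB; exact: lawmu.
  - exact: cvg_cst.
  apply: cvg_EFin; first exact: nearW.
  have -> : (0 : R) = 2 * (C1 * 0) by rewrite !mulr0.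
  by apply: cvgM; [exact: cvg_cst|apply: cvgM => //; exact: cvg_cst].
move=> ergY Phi mPhi [M PhiM] p p1.
have erg (A : set (pathT Ysp)) : measurable A -> shift_by 1 @^-1` A = A ->
    PY A = 0%E \/ PY A = 1%E.
  by move=> mA TA; exact: ergY.
set ell := \int[mu]_z Phi z.
have ellE n : `|annealed_law Q PY n Phi x0 - ell| <= 2 * M * C1 * r n.
  rewrite -(lawE n Phi M mPhi PhiM) -mulrA.
  apply: Rintegral_close => //; try exact: probability_setT.
  by move=> B mB; exact: lawmu.
have L1 := lln_L1 chain mV V0 iV QV alpha01 minor' w0 w1 mw rho01 mrho sigma01 wd ins out
  PYT mPhi PhiM erg r_cvg ellE.
have M0 : 0 <= M by exact: le_trans (PhiM point).
have ellM : `|ell| <= M by exact: Rintegral_bounded (probability_setT _) mPhi PhiM.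
apply: (Lnorm_cvg0 (M := 2 * M)) => //.
  move=> n; apply: measurable_funB => //; apply: measurable_funM => //.
  by apply: measurable_sum => k; exact: measurableT_comp mPhi _.
move=> n v; rewrite (le_trans (ler_normB _ _))// mulr_natl mulr2n lerD//.
(* At n = 0 the average is 0, the inverse of 0 being 0. *)
have [->|n0] := posnP n; first by rewrite invr0 mulr0 normr0.
have n0' : 0 < (n%:R : R) by rewrite ltr0n.
rewrite normrM normfV (ger0_norm (ltW n0')) ler_pdivrMr//.
rewrite (le_trans (ler_norm_sum _ _ _))//.
apply: (@le_trans _ _ (\sum_(1 <= k < n.+1) M)); first by apply: ler_sum.
by rewrite sumr_const_nat subn1 mulr_natr.
Qed.
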